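(* Let $b_{\rm shunt}\in\mathbb{R}^n$ and consider the closed-loop microgrid system with constant-impedance loads and controller gains $K_i<0$, $i\in\mathcal I$, $$\begin{pmatrix}\mathbf 0_n\\ \tau_I\dot E_I\end{pmatrix}=\begin{pmatrix}[E_L][b_{\rm shunt}]E_L\\ [E_I]K_I(E_I-E_I^* )\end{pmatrix}+[E]BE,\qquad E=(E_L,E_I),$$ and the optimization problem with cost coefficients $\kappa_i<0$, $i\in\mathcal I$, $$\underset{E\in\mathbb{R}^{n+m}_{>0}}{\text{minimize}}\quad C(E)=\sum_{\{i,j\}\in\mathcal E}B_{ij}(E_i-E_j)^2-\sum_{i\in\mathcal L}b_{\mathrm{shunt},i}E_i^2-\sum_{i\in\mathcal I}\kappa_i(E_i-E_i^* )^2 .$$ Assume that $-(B_{\rm red}+[b_{\rm shunt}])$ is an $M$-matrix. If $K_i=\kappa_i$ for each $i\in\mathcal I$, then the unique locally exponentially stable equilibrium $(E_L^{\rm Z},E_I^{\rm Z})\in\mathbb{R}^{n+m}_{>0}$ of the closed-loop system is equal to the unique minimizer of the optimization problem, and both are given by $$E_L^{\rm Z}=(B_{\rm red}+[b_{\rm shunt}])^{-1}B_{\rm red}E_L^*\in\mathbb{R}^n_{>0},\qquad E_I^{\rm Z}=W_2\begin{pmatrix}E_L^{\rm Z}\\ E_I^*\end{pmatrix}\in\mathbb{R}^m_{>0}.$$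
   Context: Network: $n,m\ge 1$ are integers, $\mathcal L=\{1,\dots,n\}$ is the set of load buses, $\mathcal I=\{n+1,\dots,n+m\}$ the set of inverter buses, and $G$ is a connected undirected weighted graph on $\mathcal L\cup\mathcal I$ with edge set $\mathcal E$. The susceptance matrix $B\in\mathbb{R}^{(n+m)\times(n+m)}$ is symmetric with $B_{ij}=B_{ji}>0$ if $\{i,j\}\in\mathcal E$, $B_{ij}=0$ for $i\neq j$ with $\{i,j\}\notin\mathcal E$, and $B_{ii}=-\sum_{j\ne i}B_{ij}$. For a vector $x$, $[x]$ is the diagonal matrix with $x$ on the diagonal; $\mathbf 0_n$ is the zero vector. Block partition according to loads and inverters: $E=(E_L,E_I)$ and $B=\begin{pmatrix}B_{LL}&B_{LI}\\ B_{IL}&B_{II}\end{pmatrix}$. $K_I=\mathrm{diag}(K_i)_{i\in\mathcal I}$, $\tau_I=\mathrm{diag}(\tau_i)_{i\in\mathcal I}$ with time constants $\tau_i>0$, and $E_I^*=(E_i^* )_{i\in\mathcal I}\in\mathbb{R}^m_{>0}$ is the vector of voltage set points. Define $$B_{\rm red}=B_{LL}-B_{LI}(B_{II}+K_I)^{-1}B_{IL},\qquad W_1=-B_{\rm red}^{-1}B_{LI}(B_{II}+K_I)^{-1}K_I,$$ $$W_2=(B_{II}+K_I)^{-1}\begin{pmatrix}-B_{IL}&K_I\end{pmatrix},\qquad E_L^*=W_1E_I^*.$$ (The inverses exist.) A real square matrix $A$ is an $M$-matrix if $A_{ij}\le0$ for all $i\ne j$ and all eigenvalues of $A$ have positive real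 parts. In $C$, the three terms are the total reactive power absorbed by the lines, the reactive power consumed by the loads, and the voltage deviation cost. Only equilibria in $\mathbb{R}^{n+m}_{>0}$ are considered. An equilibrium of a differential-algebraic system is locally exponentially stable if there are $\delta,c,\lambda>0$ such that from every initial condition satisfying the algebraic equations and at distance less than $\delta$ from the equilibrium there is a unique continuous solution for all $t\ge0$, and its distance to the equilibrium at time $t$ is at most $c\,e^{-\lambda t}$ times the initial distance. *)

(* Defs.v *)
(* MathComp / MathComp-Analysis, over an arbitrary R : realType. *)
From HB Require Import structures.
From mathcomp Require Import all_boot all_order all_algebra complex.
From mathcomp Require Import all_classical all_reals all_analysis.
Set Implicit Arguments.
Unset Strict Implicit.
Unset Printing Implicit Defensive.
Import Order.TTheory GRing.Theory Num.Theory.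
Import numFieldNormedType.Exports.
Local Open Scope classical_set_scope.
Local Open Scope ring_scope.

(* Buses are indexed by 'I_(n + m): the loads are the indices lshift m i with
   i : 'I_n, the inverters the indices rshift n i with i : 'I_m.  For
   E : 'cV_(n + m), E_L is usubmx E and E_I is dsubmx E; for B : 'M_(n + m),
   the blocks B_LL, B_LI, B_IL, B_II are ulsubmx, ursubmx, dlsubmx, drsubmx. *)

(* The matrix [x]; diag_mx expects a row vector. *)
Definition diagv (R : realType) (k : nat) (x : 'cV[R]_k) : 'M[R]_k :=
  diag_mx x^T.

Definition positive_vec (R : realType) (k : nat) (x : 'cV[R]_k) : Prop :=
  forall i, 0 < x i 0.

Definition negative_vec (R : realType) (k : nat) (x : 'cV[R]_k) : Prop :=
  forall i, x i 0 < 0.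

(* Eigenvalues are the complex ones. *)
Definition M_matrix (R : realType) (k : nat) (A : 'M[R]_k) : Prop :=
  (forall i j, i != j -> A i j <= 0) /\
  (forall z : complex R,
     eigenvalue (map_mx (real_complex R) A) z -> 0 < complex.Re z).

Definition connected_graph (T : finType) (e : rel T) : Prop :=
  [/\ symmetric e, irreflexive e & forall i j, connect e i j].

Definition susceptance_matrix (R : realType) (k : nat) (e : rel 'I_k)
    (B : 'M[R]_k) : Prop :=
  [/\ forall i j, B i j = B j i,
      forall i j, e i j -> 0 < B i j,
      forall i j, i != j -> ~~ e i j -> B i j = 0 &
      forall i, B i i = - \sum_(j | j != i) B i j].

Section Microgrid.
Variables (R : realType) (n m : nat).
Implicit Types (e : rel 'I_(n + m)) (B : 'M[R]_(n + m)) (E : 'cV[R]_(n + m)).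
Implicit Types (K kappa tau Estar : 'cV[R]_m) (b : 'cV[R]_n).

Definition Bred B K : 'M[R]_n :=
  ulsubmx B - ursubmx B *m invmx (drsubmx B + diagv K) *m dlsubmx B.

Definition W1 B K : 'M[R]_(n, m) :=
  - invmx (Bred B K) *m ursubmx B *m invmx (drsubmx B + diagv K) *m diagv K.

Definition W2 B K : 'M[R]_(m, n + m) :=
  invmx (drsubmx B + diagv K) *m row_mx (- dlsubmx B) (diagv K).

Definition ELstar B K Estar : 'cV[R]_n := W1 B K *m Estar.

Definition EL_Z B K b Estar : 'cV[R]_n :=
  invmx (Bred B K + diagv b) *m Bred B K *m ELstar B K Estar.

Definition EI_Z B K b Estar : 'cV[R]_m :=
  W2 B K *m col_mx (EL_Z B K b Estar) Estar.

(* Right-hand side of the closed-loop system. *)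
Definition closed_loop B K b Estar E : 'cV[R]_(n + m) :=
  col_mx (diagv (usubmx E) *m diagv b *m usubmx E)
         (diagv (dsubmx E) *m diagv K *m (dsubmx E - Estar))
  + diagv E *m B *m E.

(* Each undirected edge {i, j} is counted once, as the pair with i < j. *)
Definition cost e B kappa b Estar E : R :=
  \sum_(i < n + m) \sum_(j < n + m | (i < j)%N && e i j)
     B i j * (E i 0 - E j 0) ^+ 2
  - \sum_(i < n) b i 0 * (usubmx E i 0) ^+ 2
  - \sum_(i < m) kappa i 0 * (dsubmx E i 0 - Estar i 0) ^+ 2.

End Microgrid.

(* [v] is the derivative at [t] of [x] as a function on the half-line
   [0, +oo): two-sided for t > 0, right derivative at t = 0. *)
Definition is_derive_halfline (R : realType) (V : normedModType R)
    (x : R -> V) (t : R) (v : V) : Prop :=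
  (fun h : R => h^-1 *: (x (t + h) - x t)) @
    within [set h | 0 <= t + h] (0 : R)^' --> v.

(* The differential-algebraic system (0, T y') = F (x), x = (., y), whose
   algebraic equations are the first n components of F (x) = 0. *)
Section DAE.
Variables (R : realType) (n m : nat).
Variables (T : 'M[R]_m) (F : 'cV[R]_(n + m) -> 'cV[R]_(n + m)).

Definition dae_equilibrium (xe : 'cV[R]_(n + m)) : Prop := F xe = 0.

(* Continuous solutions on [0, +oo); only the y components are required to be
   differentiable. The values of x at negative times are irrelevant. *)
Definition dae_solution (x0 : 'cV[R]_(n + m)) (x : R -> 'cV[R]_(n + m)) : Prop :=
  [/\ x 0 = x0,
      {within `[0, +oo[, continuous x} &
      forall t : R, 0 <= t -> exists2 v : 'cV[R]_m,
        is_derive_halfline (fun s => dsubmx (x s)) t v &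
        col_mx 0 (T *m v) = F (x t)].

(* The distance is that of the sup norm. *)
Definition dae_locally_exponentially_stable (xe : 'cV[R]_(n + m)) : Prop :=
  exists delta c lambda : R,
    [/\ 0 < delta, 0 < c, 0 < lambda &
      forall x0 : 'cV[R]_(n + m),
        usubmx (F x0) = 0 -> `|x0 - xe| < delta ->
        exists x : R -> 'cV[R]_(n + m),
          [/\ dae_solution x0 x,
              forall y, dae_solution x0 y -> forall t : R, 0 <= t -> y t = x t &
              forall t : R, 0 <= t ->
                `|x t - xe| <= c * expR (- lambda * t) * `|x0 - xe|]].

End DAE.

Definition positive_minimizer (R : realType) (k : nat) (C : 'cV[R]_k -> R)
    (E : 'cV[R]_k) : Prop :=
  positive_vec E /\ forall E', positive_vec E' -> C E <= C E'.

(* Main.v *)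
Require Import Defs.
From HB Require Import structures.
From mathcomp Require Import all_boot all_order all_algebra complex.
From mathcomp Require Import all_classical all_reals all_analysis.
From mathcomp Require Import ring lra.
Import Order.TTheory GRing.Theory Num.Theory.
Import numFieldNormedType.Exports.
Local Open Scope ring_scope.

(** Put A = B + diag(b, K) and c = (0, K Estar).  The closed loop is
    [E] (A E - c), and, since the energy absorbed by the lines is the quadratic form of -B,
    the cost differs by a constant from the quadratic function with gradient
    -2 (A E - c).  So everything is about the matrix -A and the vector Ez with
    A Ez = c, which block elimination of the inverters identifies with the
    stated formulas.

    The Schur complement of the inverter block of -A is the given M-matrix.  It
    is symmetric, so by the spectral theorem its positive eigenvalues make it
    positive definite; the inverter block is a grounded Laplacian, hence
    positive definite too, and so is -A (grid_posdef).  Off the diagonal -A is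
    nonpositive, with the connected graph as its pattern, and -c is nonnegative
    and nonzero: this makes Ez positive (stieltjes_positive).  Positive
    definiteness makes Ez the only minimizer (cost_sub), and the only
    positive equilibrium, as [E] can then be cancelled.

    For stability (gradient_dae_stable), the load equations are linear near Ez
    and express the loads through the deviation u of the inverters.  What
    remains is the Lotka-Volterra equation tau u' = - [z + u] S u, where S is
    the Schur complement of the load block of -A and z the inverter part of
    Ez.  The form of S is a Lyapunov function with derivative bounded by a
    negative multiple of itself (lotka_flow).  Existence for all times comes
    from a global Picard-Lindelof theorem (lipschitz_flow) after a truncation
    that small trajectories never meet; uniqueness comes from Gronwall's
    inequality (ode_unique) together with the fact that a solution cannot leave
    the neighbourhood where the load equations are linear (first_exit). *)

Set Implicit Arguments.
Unset Strict Implicit.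
Unset Printing Implicit Defensive.

(** * Positive definite forms *)

Section QuadraticForms.
Context {R : realType}.
Local Open Scope sesquilinear_scope.

Definition qform k (Q : 'M[R]_k) (x : 'cV[R]_k) : R := (x^T *m Q *m x) 0 0.

(** The form only sees the symmetric part of Q. *)
Definition posdef k (Q : 'M[R]_k) : Prop := forall x, x != 0 -> 0 < qform Q x.

Lemma qformE k (Q : 'M[R]_k) x :
  qform Q x = \sum_i \sum_j Q i j * x i 0 * x j 0.
Proof.
rewrite /qform -mulmxA mxE; apply: eq_bigr => i _.
rewrite !mxE mulr_sumr; apply: eq_bigr => j _; ring.
Qed.

Lemma qform_sum k (Q : 'M[R]_k) x :
  qform Q x = \sum_i x i 0 * (Q *m x) i 0.
Proof. by rewrite /qform -mulmxA mxE; apply: eq_bigr => i _; rewrite mxE. Qed.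

Lemma posdef_ge0 k (Q : 'M[R]_k) x : posdef Q -> 0 <= qform Q x.
Proof.
move=> Qpos; have [->|/Qpos/ltW//] := eqVneq x 0.
by rewrite /qform mulmx0 mxE.
Qed.

Lemma posdef_unitmx k (Q : 'M[R]_k) : posdef Q -> Q \in unitmx.
Proof.
move=> Qpos; rewrite -row_free_unit; apply: inj_row_free => v vQ.
apply/eqP; rewrite -trmx_eq0; apply/negP => /negP/Qpos.
by rewrite /qform trmxK vQ mul0mx mxE ltxx.
Qed.

Lemma posdefN_unitmx k (Q : 'M[R]_k) : posdef (- Q) -> Q \in unitmx.
Proof.
move=> /posdef_unitmx; rewrite -scaleN1r unitmxZ //.
by rewrite unitrN unitr1.
Qed.

(** The spectral theorem: a unitary change of basis turns the form of a
    symmetric matrix into a combination of squares weighted by its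
    eigenvalues. *)
Lemma posdef_eigenvalues k (Q : 'M[R]_k) : Q^T = Q ->
  (forall z : complex R, eigenvalue (map_mx (real_complex R) Q) z ->
     0 < complex.Re z) ->
  posdef Q.
Proof.
move=> Qsym Qeig x x0.
set Qc := map_mx (real_complex R) Q.
have hermQ : Qc \is hermsymmx.
  apply/is_hermitianmxP; rewrite expr0 scale1r; apply/matrixP => i j.
  rewrite !mxE -[Q in LHS]Qsym mxE.
  by apply/eqP; rewrite eq_complex /= oppr0 !eqxx.
have /orthomx_spectralP := hermitian_normalmx hermQ.
set P := spectralmx Qc; set D := spectral_diag Qc => QcE.
have Punitary : P \is unitarymx := spectral_unitarymx Qc.
have Punit : P \in unitmx := spectral_unit Qc.
have Dpos i : 0 < D 0 i.
  have /mxOverP/(_ 0 i) Dreal := hermitian_spectral_diag_real hermQ.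
  rewrite -/D in Dreal.
  suff : 0 < complex.Re (D 0 i).
    move: Dreal; case: (D 0 i) => [a b]; rewrite complex_real => /eqP -> /= a0.
    by rewrite ltcE /= eqxx.
  apply: Qeig; apply/eigenvalueP; exists (row i P).
    rewrite -/Qc {1}QcE -row_mul !mulmxA mulmxV // mul1mx mul_diag_mx.
    by apply/rowP => j; rewrite !mxE.
  rewrite rowE mul_mx_rowfree_eq0 ?row_free_unit //.
  by apply/negP => /eqP/matrixP/(_ 0 i)/eqP; rewrite !mxE !eqxx oner_eq0.
pose y := P *m map_mx (real_complex R) x.
have y_neq0 : y != 0.
  apply: contraNneq x0 => y0.
  rewrite -(map_mx_eq0 (real_complex R)).
  by rewrite -[X in X == 0](mulKmx Punit) -/y y0 mulmx0.
suff qE : (qform Q x)%:C%C = \sum_i D 0 i * (y i 0 * (y i 0)^*).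
  have : 0 < (qform Q x)%:C%C.
    rewrite qE; have [i yi0] : exists i, y i 0 != 0.
      apply/existsP; apply: contraNT y_neq0 => /existsPn y0.
      by apply/eqP/colP => i; rewrite [RHS]mxE; apply/eqP; move: (y0 i); rewrite negbK.
    rewrite (bigD1 i) //= ltr_wpDr //.
      by apply: sumr_ge0 => j _; rewrite mulr_ge0 ?(ltW (Dpos j)) ?mul_conjC_ge0.
    by rewrite mulr_gt0 // mul_conjC_gt0.
  by rewrite ltcE /= eqxx.
have -> : (qform Q x)%:C%C = (map_mx (real_complex R) (x^T *m Q *m x)) 0 0.
  by rewrite mxE.
rewrite !map_mxM -/Qc QcE invmx_unitary //.
have -> : map_mx (real_complex R) x^T = (map_mx (real_complex R) x)^t*.
  apply/matrixP => i j; rewrite !mxE.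
  by apply/eqP; rewrite eq_complex /= oppr0 !eqxx.
transitivity ((y^t* *m diag_mx D *m y) 0 0).
  by rewrite /y trmx_mul map_mxM !mulmxA.
rewrite mxE; apply: eq_bigr => i _.
by rewrite mul_mx_diag !mxE; ring.
Qed.

(** Completing the square: with x = (u, v) and D the lower right block, the
    form is that of the Schur complement at u plus that of D at
    v + D^-1 Q_dl u. *)
Lemma posdef_schur n m (Q : 'M[R]_(n + m)) : Q^T = Q ->
  posdef (drsubmx Q) ->
  posdef (ulsubmx Q - ursubmx Q *m invmx (drsubmx Q) *m dlsubmx Q) ->
  posdef Q.
Proof.
move=> Qsym Dpos Spos x x0.
have Dunit := posdef_unitmx Dpos.
have Dsym : (drsubmx Q)^T = drsubmx Q by rewrite trmx_drsub Qsym.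
have Osym : (ursubmx Q)^T = dlsubmx Q by rewrite trmx_ursub Qsym.
pose u := usubmx x; pose v := dsubmx x.
pose w := v + invmx (drsubmx Q) *m dlsubmx Q *m u.
have qE : qform Q x = qform (ulsubmx Q - ursubmx Q *m invmx (drsubmx Q) *m
    dlsubmx Q) u + qform (drsubmx Q) w.
  rewrite /qform -{1 2}[x]vsubmxK -{1}[Q]submxK tr_col_mx -/u -/v.
  rewrite mul_row_block mul_row_col /w.
  rewrite [(v + _)^T]raddfD /= !trmx_mul -Osym trmxK trmx_inv Dsym.
  rewrite !(mulmxDl, mulmxDr, mulmxN, mulNmx) !mulmxA.
  rewrite !(mulmxKV Dunit) !(mulmxK Dunit) !mxE; ring.
rewrite qE; have [u0|u0] := eqVneq u 0.
  rewrite ltr_wpDl ?posdef_ge0 //; apply: Dpos.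
  rewrite /w u0 mulmx0 addr0; apply: contraNneq x0 => v0.
  by rewrite -[x]vsubmxK -/u -/v u0 v0 col_mx0.
by rewrite ltr_pwDl ?posdef_ge0 //; exact: Spos.
Qed.

(** Cauchy-Schwarz for the form of Q, applied to x and Q^-1 e_i. *)
Lemma posdef_coord_le k (Q : 'M[R]_k) (x : 'cV[R]_k) i : Q^T = Q -> posdef Q ->
  x i 0 ^+ 2 <= invmx Q i i * qform Q x.
Proof.
move=> Qsym Qpos; have Qunit := posdef_unitmx Qpos.
pose w : 'cV[R]_k := invmx Q *m delta_mx i 0.
have Qw : Q *m w = delta_mx i 0 by rewrite mulKVmx.
have xe (z : 'cV[R]_k) : (z^T *m delta_mx i 0) 0 0 = z i 0.
  rewrite mxE (bigD1 i) //= big1 ?addr0; first by rewrite !mxE !eqxx mulr1.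
  by move=> j ji; rewrite !mxE (negPf ji) mulr0.
have qw : qform Q w = invmx Q i i.
  by rewrite /qform -mulmxA Qw xe /w -colE mxE.
have wx : (w^T *m Q *m x) 0 0 = x i 0.
  have -> : w^T *m Q *m x = (x^T *m Q *m w)^T.
    by rewrite !trmx_mul trmxK Qsym mulmxA.
  by rewrite mxE -mulmxA Qw xe.
have w0 : w != 0.
  apply/negP => /eqP w0; have /matrixP/(_ i 0)/eqP := Qw.
  by rewrite w0 mulmx0 !mxE !eqxx eq_sym oner_eq0.
have q0 : 0 < invmx Q i i by rewrite -qw; exact: Qpos.
pose y := invmx Q i i *: x - x i 0 *: w.
have : 0 <= qform Q y by exact: posdef_ge0.
have -> : qform Q y = invmx Q i i * (invmx Q i i * qform Q x - x i 0 ^+ 2).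
  have qx : (x^T *m Q *m w) 0 0 = x i 0 by rewrite -mulmxA Qw xe.
  have yT : y^T = invmx Q i i *: x^T - x i 0 *: w^T.
    by apply/matrixP => p q; rewrite !mxE.
  rewrite /qform yT /y !(mulmxBl, mulmxBr) -!scalemxAl -!scalemxAr.
  move: qw; rewrite /qform.
  move: wx qx; set a := w^T *m _ *m x; set c := x^T *m _ *m w.
  set d := w^T *m _ *m w; set f := x^T *m _ *m x.
  move: a c d f => a c d f wx qx qw.
  by rewrite !mxE wx qx qw; ring.
by rewrite pmulr_rge0 // subr_ge0.
Qed.

(** Only a bound for the form by the Euclidean norm is needed, so the crude
    entrywise constant is enough. *)
Lemma qform_le k (Q : 'M[R]_k) (x : 'cV[R]_k) :
  qform Q x <= (\sum_i \sum_j `|Q i j|) * \sum_i x i 0 ^+ 2.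
Proof.
rewrite qformE mulr_suml; apply: ler_sum => i _.
rewrite mulr_suml; apply: ler_sum => j _.
rewrite -mulrA; apply: le_trans (ler_norm _) _; rewrite normrM.
apply: ler_wpM2l => //; rewrite normrM.
have h l : x l 0 ^+ 2 <= \sum_i x i 0 ^+ 2.
  by rewrite (bigD1 l) //= lerDl sumr_ge0 // => ? _; exact: sqr_ge0.
have := h i; have := h j; have := sqr_ge0 (`|x i 0| - `|x j 0|).
rewrite -(real_normK (num_real (x i 0))) -(real_normK (num_real (x j 0))).
nra.
Qed.

End QuadraticForms.

Section Blocks.
Context {R : realType}.

Lemma posdef_drsub n m (Q : 'M[R]_(n + m)) : posdef Q -> posdef (drsubmx Q).
Proof.
move=> Qpos y y0; have /Qpos : col_mx 0 y != 0 :> 'cV_(n + m).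
  by rewrite col_mx_eq0 eqxx.
rewrite /qform -{1}[Q]submxK tr_col_mx mul_row_block mul_row_col.
by rewrite trmx0 !mul0mx mulmx0 !add0r.
Qed.

Lemma posdef_ulsub n m (Q : 'M[R]_(n + m)) : posdef Q -> posdef (ulsubmx Q).
Proof.
move=> Qpos y y0; have /Qpos : col_mx y 0 != 0 :> 'cV_(n + m).
  by rewrite col_mx_eq0 eqxx andbT.
rewrite /qform -{1}[Q]submxK tr_col_mx mul_row_block mul_row_col.
by rewrite trmx0 !mul0mx mulmx0 !addr0.
Qed.

(** A vector in the kernel of the Schur complement lifts to a kernel vector of
    the whole matrix. *)
Lemma schur_unitmx n m (Q : 'M[R]_(n + m)) :
  Q \in unitmx -> drsubmx Q \in unitmx ->
  ulsubmx Q - ursubmx Q *m invmx (drsubmx Q) *m dlsubmx Q \in unitmx.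
Proof.
move=> Qu Du; rewrite -unitmx_tr -row_free_unit; apply: inj_row_free => v.
move/(congr1 trmx); rewrite trmx_mul trmxK trmx0 => Sv.
pose x := col_mx v^T (- (invmx (drsubmx Q) *m dlsubmx Q *m v^T)).
have Qx : Q *m x = 0.
  rewrite -[Q]submxK mul_block_col !mulmxN !mulmxA mulmxV // mul1mx subrr.
  by rewrite -mulmxBl Sv col_mx0.
have : x = 0 by rewrite -[x](mulKmx Qu) Qx mulmx0.
rewrite -[0 in RHS]col_mx0 => /eq_col_mx[/(congr1 trmx)].
by rewrite trmxK trmx0.
Qed.

Lemma diagv_mulE k p (x : 'cV[R]_k) (M : 'M[R]_(k, p)) i j :
  (diagv x *m M) i j = x i 0 * M i j.
Proof. by rewrite mul_diag_mx !mxE. Qed.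

Lemma qform_diagv k (d x : 'cV[R]_k) :
  qform (diagv d) x = \sum_i d i 0 * x i 0 ^+ 2.
Proof.
by rewrite qform_sum; apply: eq_bigr => i _; rewrite diagv_mulE; ring.
Qed.

Lemma qformD k (P Q : 'M[R]_k) x : qform (P + Q) x = qform P x + qform Q x.
Proof. by rewrite /qform mulmxDr mulmxDl mxE. Qed.

Lemma qformN k (Q : 'M[R]_k) x : qform (- Q) x = - qform Q x.
Proof. by rewrite /qform mulmxN mulNmx mxE. Qed.

End Blocks.

(** * Laplacians and Stieltjes matrices on a connected graph *)

Section Graph.
Context {R : realType} {k : nat}.
Variables (e : rel 'I_k) (B : 'M[R]_k).
Hypotheses (graph_e : connected_graph e) (susc_B : susceptance_matrix e B).

Lemma connected_spread (P : 'I_k -> Prop) i0 :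
  (forall i j, e i j -> P i -> P j) -> P i0 -> forall j, P j.
Proof.
move=> Pe + j; have [_ _ /(_ i0 j)/connectP[p + ->]] := graph_e.
by elim: p i0 => //= a p IH i /andP[/Pe ia /IH ap] /ia/ap.
Qed.

Lemma susc_offdiag_ge0 i j : i != j -> 0 <= B i j.
Proof.
move=> ij; have [_ Bpos B0 _] := susc_B.
by have [/Bpos/ltW//|/(B0 _ _ ij)->] := boolP (e i j).
Qed.

Lemma susc_row_sum i : \sum_j B i j = 0.
Proof.
have [_ _ _ Bd] := susc_B.
by rewrite (bigD1 i) //= Bd addNr.
Qed.

(** The rows of B sum to zero, so the squares in the expansion cancel and only
    the cross terms remain. *)
Lemma susc_qform (x : 'cV[R]_k) :
  \sum_i \sum_j B i j * (x i 0 - x j 0) ^+ 2 = - (2 * qform B x).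
Proof.
have [Bsym _ _ _] := susc_B.
transitivity (\sum_i \sum_j B i j * x i 0 ^+ 2 +
  \sum_i \sum_j B i j * x j 0 ^+ 2 - 2 * qform B x).
  rewrite qformE mulr_sumr -big_split -sumrB; apply: eq_bigr => i _ /=.
  rewrite mulr_sumr -big_split -sumrB; apply: eq_bigr => j _ /=; ring.
have S0 : \sum_i \sum_j B i j * x i 0 ^+ 2 = 0.
  by apply: big1 => i _; rewrite -mulr_suml susc_row_sum mul0r.
rewrite S0 exchange_big /= [X in _ + X - _](_ : _ = 0) ?addr0 ?sub0r //.
rewrite -[RHS]S0; apply: eq_bigr => i _; apply: eq_bigr => j _.
by rewrite Bsym.
Qed.

Lemma susc_edge_sum (x : 'cV[R]_k) :
  \sum_(i < k) \sum_(j < k | (i < j)%N && e i j) B i j * (x i 0 - x j 0) ^+ 2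
  = - qform B x.
Proof.
have [Bsym _ B0 _] := susc_B.
pose f i j := B i j * (x i 0 - x j 0) ^+ 2.
have E1 : \sum_(i < k) \sum_(j < k | (i < j)%N && e i j) f i j =
    \sum_(i < k) \sum_(j < k | (i < j)%N) f i j.
  apply: eq_bigr => i _; rewrite [RHS](bigID (e i)) /=.
  rewrite [X in _ = _ + X]big1 ?addr0 // => j /andP[ij nij].
  by rewrite /f B0 ?mul0r // neq_ltn ij.
have E2 : \sum_i \sum_j f i j = \sum_(i < k) \sum_(j < k | (i < j)%N) f i j +
    \sum_(i < k) \sum_(j < k | (j < i)%N) f i j.
  rewrite -big_split; apply: eq_bigr => i _ /=.
  rewrite (bigID (fun j : 'I_k => (i < j)%N)) /=; congr (_ + _).
  rewrite (bigID (fun j : 'I_k => (j < i)%N)) /= [X in _ + X]big1 ?addr0.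
    by apply: eq_bigl => j; rewrite -leqNgt; case: ltngtP.
  move=> j /andP[]; rewrite -!leqNgt => ji ij.
  have -> : j = i by apply/val_inj/eqP; rewrite eqn_leq ji ij.
  by rewrite /f subrr expr0n mulr0.
have E3 : \sum_(i < k) \sum_(j < k | (j < i)%N) f i j =
    \sum_(i < k) \sum_(j < k | (i < j)%N) f i j.
  rewrite (exchange_big_dep predT) //=; apply: eq_bigr => i _.
  by apply: eq_bigr => j _; rewrite /f Bsym -opprB sqrrN.
have : \sum_i \sum_j f i j = - (2 * qform B x) := susc_qform x.
rewrite [LHS in _ -> LHS = _]E1 E2 E3; lra.
Qed.

(** A vector with zero Laplacian energy is constant on the connected graph,
    and one weight of d then forces the constant to vanish. *)
Lemma laplacian_posdef (d : 'cV[R]_k) i0 :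
  (forall i, 0 <= d i 0) -> 0 < d i0 0 -> posdef (diagv d - B).
Proof.
move=> d0 di0 x x0.
have Bx i j : 0 <= B i j * (x i 0 - x j 0) ^+ 2.
  have [->|ij] := eqVneq i j; first by rewrite subrr expr0n mulr0.
  by rewrite mulr_ge0 ?susc_offdiag_ge0 ?sqr_ge0.
have dx i : 0 <= d i 0 * x i 0 ^+ 2 by rewrite mulr_ge0 ?sqr_ge0.
rewrite qformD qformN qform_diagv.
have Sd : 0 <= \sum_i d i 0 * x i 0 ^+ 2 by apply: sumr_ge0.
have SBi i : 0 <= \sum_j B i j * (x i 0 - x j 0) ^+ 2 by apply: sumr_ge0.
have SB : 0 <= \sum_i \sum_j B i j * (x i 0 - x j 0) ^+ 2.
  by apply: sumr_ge0 => i _.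
have BE := susc_qform x.
rewrite lt_neqAle; apply/andP; split; last by lra.
apply: contraNneq x0 => q0.
have Sd0 : \sum_i d i 0 * x i 0 ^+ 2 = 0 by lra.
have SB0 : \sum_i \sum_j B i j * (x i 0 - x j 0) ^+ 2 = 0 by lra.
have xi0 : x i0 0 = 0.
  have := @psumr_eq0P _ _ predT _ (fun i _ => dx i) Sd0 i0 isT.
  by move/eqP; rewrite mulf_eq0 gt_eqF //= expf_eq0 => /eqP.
apply/eqP/colP => j; rewrite mxE.
apply: (connected_spread (P := fun j => x j 0 = 0)) xi0 _ => {}j l ejl xj.
have := @psumr_eq0P _ _ predT _ (fun i _ => SBi i) SB0 j isT.
move=> /(@psumr_eq0P _ _ predT _ (fun i _ => Bx j i))/(_ l isT)/eqP.
have [_ /(_ _ _ ejl) Bjl _ _] := susc_B.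
by rewrite xj sub0r sqrrN mulf_eq0 gt_eqF //= expf_eq0 => /eqP.
Qed.

(** Testing the equation Q x = w against the negative part of x shows that
    x is nonnegative; at a zero of x all the neighbours vanish as well, so that
    by connectedness a zero would force w to vanish everywhere. *)
Lemma stieltjes_positive (Q : 'M[R]_k) (x w : 'cV[R]_k) i0 :
  posdef Q -> (forall i j, i != j -> Q i j <= 0) ->
  (forall i j, e i j -> Q i j < 0) ->
  Q *m x = w -> (forall i, 0 <= w i 0) -> 0 < w i0 0 -> positive_vec x.
Proof.
move=> Qpos Qle0 Qlt0 Qx w0 wi0.
(* xm is the negative part of x, with its sign; xm i * (x i - xm i) = 0 *)
pose xm : 'cV[R]_k := \col_i Num.min (x i 0) 0.
have xm_le0 i : xm i 0 <= 0 by rewrite mxE ge_min lexx orbT.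
have xm_le i : xm i 0 <= x i 0 by rewrite mxE ge_min lexx.
have xm_or i : xm i 0 = 0 \/ xm i 0 = x i 0.
  by rewrite mxE minEle; case: ifP; [right|left].
have xge0 i : 0 <= x i 0.
  suff xm0 : xm = 0 by have := xm_le i; rewrite xm0 mxE.
  apply/eqP/negP => /negP/Qpos; apply/negP; rewrite -leNgt.
  have le0 : \sum_i xm i 0 * (Q *m x) i 0 <= 0.
    apply: sumr_le0 => j _; rewrite Qx.
    by rewrite mulr_le0_ge0.
  apply: le_trans le0; rewrite qform_sum; apply: ler_sum => j _.
  have mulE (y : 'cV_k) : (Q *m y) j 0 = \sum_l Q j l * y l 0 by rewrite mxE.
  rewrite !mulE !mulr_sumr; apply: ler_sum => l _.
  have [jl|jl] := eqVneq j l.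
    by subst l; case: (xm_or j) => ->; rewrite ?mul0r.
  apply: ler_wnM2l => //; apply: ler_wnM2l; first exact: Qle0.
  exact: xm_le.
have x0_spread i j : e i j -> x i 0 = 0 -> x j 0 = 0.
  move=> eij xi0; have := w0 i; rewrite -Qx mxE -oppr_le0 -sumrN => S.
  have term l : 0 <= - (Q i l * x l 0).
    have [<-|il] := eqVneq i l; first by rewrite xi0 mulr0 oppr0.
    by rewrite oppr_ge0 mulr_le0_ge0 ?Qle0.
  have S0 : \sum_l - (Q i l * x l 0) = 0.
    by apply/eqP; rewrite eq_le S sumr_ge0.
  have /eqP := @psumr_eq0P _ _ predT _ (fun l _ => term l) S0 j isT.
  by rewrite oppr_eq0 mulf_eq0 lt_eqF ?Qlt0 //= => /eqP.
move=> i; rewrite lt_neqAle xge0 andbT eq_sym; apply/negP => /eqP xi0.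
have x0 := connected_spread (P := fun j => x j 0 = 0) x0_spread xi0.
have : x = 0 by apply/colP => j; rewrite mxE.
by move=> x_eq0; move: wi0; rewrite -Qx x_eq0 mulmx0 mxE ltxx.
Qed.

End Graph.

(** * The grid matrix *)

Section Grid.
Context {R : realType} {n m : nat}.
Variables (e : rel 'I_(n + m)) (B : 'M[R]_(n + m)).
Variables (K Estar : 'cV[R]_m) (b : 'cV[R]_n).

(** With this matrix A and the right-hand side c below, the closed loop reads
    [E] (A E - c), and the cost has gradient -2 (A E - c) when K = kappa. *)
Definition grid_mx : 'M[R]_(n + m) := B + diagv (col_mx b K).

Definition grid_rhs : 'cV[R]_(n + m) := col_mx 0 (diagv K *m Estar).

Lemma diagv_col_mx :
  diagv (col_mx b K) = block_mx (diagv b) 0 0 (diagv K).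
Proof. by rewrite /diagv tr_col_mx diag_mx_row. Qed.

Lemma grid_mxE : grid_mx = block_mx (ulsubmx B + diagv b) (ursubmx B)
  (dlsubmx B) (drsubmx B + diagv K).
Proof.
by rewrite /grid_mx diagv_col_mx -{1}[B]submxK add_block_mx !addr0.
Qed.

Lemma closed_loopE E :
  closed_loop B K b Estar E = diagv E *m (grid_mx *m E - grid_rhs).
Proof.
rewrite /closed_loop /grid_mx /grid_rhs; apply/colP => i.
have addE (x y z : 'cV[R]_(n + m)) : (x + y - z) i 0 = x i 0 + y i 0 - z i 0.
  by rewrite !mxE.
rewrite [LHS]mxE -[diagv E *m B *m E]mulmxA !diagv_mulE mulmxDl addE diagv_mulE.
move: ((B *m E) i 0) => v; case: (split_ordP i) => j ->.
  by rewrite !col_mxEu -mulmxA !diagv_mulE !mxE; ring.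
rewrite !col_mxEd -mulmxA !diagv_mulE.
have -> : (dsubmx E - Estar) j 0 = E (rshift n j) 0 - Estar j 0.
  by rewrite !mxE.
by rewrite mxE; ring.
Qed.

(** Expanding at the critical point Ez removes the linear term, so the cost
    exceeds its value at Ez by a pure quadratic form, whatever the sign of that
    form. *)
Lemma cost_sub E Ez : susceptance_matrix e B -> grid_mx *m Ez = grid_rhs ->
  cost e B K b Estar E - cost e B K b Estar Ez = qform (- grid_mx) (E - Ez).
Proof.
move=> susc_B Az; have [Bsym _ _ _] := susc_B.
have Asym : grid_mx^T = grid_mx.
  by apply/matrixP => i j; rewrite !mxE Bsym eq_sym; case: eqP => [->|].
pose k0 := \sum_i K i 0 * Estar i 0 ^+ 2.
have costE F : cost e B K b Estar F =
    qform (- grid_mx) F + 2 * (F^T *m grid_rhs) 0 0 - k0.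
  have S1 : \sum_i col_mx b K i 0 * F i 0 ^+ 2 =
      \sum_i b i 0 * usubmx F i 0 ^+ 2 + \sum_i K i 0 * dsubmx F i 0 ^+ 2.
    rewrite big_split_ord /=; congr (_ + _); apply: eq_bigr => i _.
      by rewrite col_mxEu mxE.
    by rewrite col_mxEd mxE.
  have S2 : (F^T *m grid_rhs) 0 0 = \sum_i dsubmx F i 0 * (K i 0 * Estar i 0).
    rewrite mxE big_split_ord /= big1 ?add0r => [|i _].
      by apply: eq_bigr => i _; rewrite col_mxEd diagv_mulE !mxE.
    by rewrite col_mxEu !mxE mulr0.
  have S3 : \sum_i K i 0 * (dsubmx F i 0 - Estar i 0) ^+ 2 =
      \sum_i K i 0 * dsubmx F i 0 ^+ 2
      - 2 * (\sum_i dsubmx F i 0 * (K i 0 * Estar i 0)) + k0.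
    rewrite mulr_sumr -sumrB -big_split; apply: eq_bigr => i _ /=.
    by ring.
  rewrite /cost susc_edge_sum // qformN /grid_mx qformD qform_diagv.
  by rewrite S1 S2 S3; ring.
rewrite !costE.
have EzE : (Ez^T *m grid_rhs) 0 0 = qform grid_mx Ez.
  by rewrite /qform -mulmxA Az.
have FE : (E^T *m grid_rhs) 0 0 = (E^T *m grid_mx *m Ez) 0 0.
  by rewrite -mulmxA Az.
have FE' : (E^T *m grid_mx *m Ez) 0 0 = (Ez^T *m grid_mx *m E) 0 0.
  have -> : Ez^T *m grid_mx *m E = (E^T *m grid_mx *m Ez)^T.
    by rewrite !trmx_mul trmxK Asym mulmxA.
  by rewrite [RHS]mxE.
rewrite EzE FE !qformN /qform [(E - Ez)^T]raddfB /=.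
rewrite !(mulmxBl, mulmxBr); move: FE'.
move: (E^T *m grid_mx *m Ez) (Ez^T *m grid_mx *m E) (Ez^T *m grid_mx *m Ez)
  (E^T *m grid_mx *m E) => u v w x.
by rewrite !mxE => uv; rewrite uv; ring.
Qed.

Lemma Bred_shunt : Bred B K + diagv b =
  ulsubmx grid_mx - ursubmx grid_mx *m invmx (drsubmx grid_mx) *m
  dlsubmx grid_mx.
Proof.
rewrite grid_mxE block_mxKul block_mxKur block_mxKdl block_mxKdr /Bred.
by rewrite addrAC.
Qed.

(** The closed formulas come from block elimination of the inverters. *)
Lemma grid_solution :
  drsubmx B + diagv K \in unitmx -> Bred B K \in unitmx ->
  Bred B K + diagv b \in unitmx ->
  grid_mx *m col_mx (EL_Z B K b Estar) (EI_Z B K b Estar) = grid_rhs.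
Proof.
move=> Du Ru Su; rewrite grid_mxE mul_block_col /grid_rhs.
set EL := EL_Z _ _ _ _.
have EIE : (drsubmx B + diagv K) *m EI_Z B K b Estar =
    diagv K *m Estar - dlsubmx B *m EL.
  rewrite /EI_Z /W2 -!mulmxA mulKVmx // mul_row_col mulNmx addrC.
  by rewrite [in LHS]addrC [LHS]addrC.
congr col_mx; last by rewrite EIE addrC subrK.
have ELE : (Bred B K + diagv b) *m EL =
    - (ursubmx B *m invmx (drsubmx B + diagv K) *m diagv K *m Estar).
  rewrite /EL /EL_Z /ELstar /W1 -!mulmxA mulKVmx // !mulNmx !mulmxN.
  by rewrite mulKVmx.
rewrite -[EI_Z _ _ _ _](mulKmx Du) EIE.
have -> : ulsubmx B + diagv b = Bred B K + diagv b +
    ursubmx B *m invmx (drsubmx B + diagv K) *m dlsubmx B.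
  by rewrite /Bred addrAC subrK.
rewrite mulmxDl ELE !mulmxBr !mulmxA.

by rewrite addrACA addNr subrr addr0.
Qed.

End Grid.

Section GridPositivity.
Context {R : realType} {n m : nat}.
Variables (e : rel 'I_(n + m)) (B : 'M[R]_(n + m)) (K : 'cV[R]_m).
Hypotheses (m_gt0 : (0 < m)%N) (graph_e : connected_graph e).
Hypotheses (susc_B : susceptance_matrix e B) (K_lt0 : negative_vec K).

Let i0 : 'I_(n + m) := rshift n (Ordinal m_gt0).

Lemma grid_mx_sym (b : 'cV[R]_n) : (grid_mx B K b)^T = grid_mx B K b.
Proof.
have [Bsym _ _ _] := susc_B.
apply/matrixP => i j; rewrite /grid_mx !mxE Bsym eq_sym.
by case: eqP => [->|].
Qed.

(** Without shunts, minus the grid matrix is a Laplacian plus a nonnegative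
    diagonal that charges the inverters. *)
Lemma unshunted_posdef : posdef (- grid_mx B K (0 : 'cV[R]_n)).
Proof.
have diagvN k (x : 'cV[R]_k) : diagv (- x) = - diagv x.
  by apply/matrixP => i j; rewrite !mxE mulNrn.
rewrite /grid_mx opprD addrC -diagvN.
apply: (laplacian_posdef graph_e susc_B (i0 := i0)) => [i|].
  case: (split_ordP i) => j ->; rewrite [X in 0 <= X]mxE ?col_mxEu ?col_mxEd.
    by rewrite mxE oppr0.
  by rewrite oppr_ge0 ltW // K_lt0.
by rewrite [X in 0 < X]mxE col_mxEd oppr_gt0 K_lt0.
Qed.

Lemma inverter_block_posdef : posdef (- (drsubmx B + diagv K)).
Proof.
have := posdef_drsub unshunted_posdef; rewrite grid_mxE.
by rewrite opp_block_mx block_mxKdr.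
Qed.

Lemma inverter_block_unitmx : drsubmx B + diagv K \in unitmx.
Proof. exact/posdefN_unitmx/inverter_block_posdef. Qed.

Lemma Bred_unitmx : Bred B K \in unitmx.
Proof.
have -> : Bred B K = Bred B K + diagv (0 : 'cV[R]_n).
  by rewrite /diagv trmx0 raddf0 addr0.
rewrite Bred_shunt; apply: schur_unitmx.
  exact/posdefN_unitmx/unshunted_posdef.
by rewrite grid_mxE block_mxKdr; exact: inverter_block_unitmx.
Qed.

Variable b : 'cV[R]_n.
Hypothesis M_shunt : M_matrix (- (Bred B K + diagv b)).

Lemma shunted_Bred_posdef : posdef (- (Bred B K + diagv b)).
Proof.
apply: posdef_eigenvalues; last by case: M_shunt.
rewrite Bred_shunt raddfN /= raddfB /= !trmx_mul trmx_inv.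
rewrite trmx_drsub trmx_ursub trmx_dlsub trmx_ulsub grid_mx_sym.
by rewrite mulmxA.
Qed.

(** The M-matrix is the Schur complement of the inverter block, and the
    inverter block is definite on its own. *)
Lemma grid_posdef : posdef (- grid_mx B K b).
Proof.
pose A := grid_mx B K b.
apply: posdef_schur; first by rewrite raddfN /= grid_mx_sym.
  rewrite grid_mxE opp_block_mx block_mxKdr; exact: inverter_block_posdef.
rewrite -/A.
have [-> -> -> ->] : [/\ ulsubmx (- A) = - ulsubmx A,
    ursubmx (- A) = - ursubmx A, dlsubmx (- A) = - dlsubmx A &
    drsubmx (- A) = - drsubmx A].
  by split; apply/matrixP => i j; rewrite !mxE.
have invN : invmx (- drsubmx A) = - invmx (drsubmx A).
  rewrite -scaleN1r invmxZ ?invrN1 ?scaleN1r // -scaleN1r unitmxZ ?unitrN1 //.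
  by rewrite /A grid_mxE block_mxKdr; exact: inverter_block_unitmx.
move: shunted_Bred_posdef; rewrite Bred_shunt -/A invN.
by rewrite !(mulmxN, mulNmx) !opprK opprD opprK.
Qed.

Lemma grid_solution_positive (Estar : 'cV[R]_m) (Ez : 'cV[R]_(n + m)) :
  positive_vec Estar -> grid_mx B K b *m Ez = grid_rhs K Estar ->
  positive_vec Ez.
Proof.
move=> Estar_gt0 Az; have [_ Bpos _ _] := susc_B.
apply: (stieltjes_positive graph_e (Q := - grid_mx B K b)
  (w := - grid_rhs K Estar) (i0 := i0)); first exact: grid_posdef.
- move=> i j ij; rewrite !mxE oppr_le0 (negPf ij) mulr0n addr0.
  exact: (susc_offdiag_ge0 susc_B).
- move=> i j eij; have ij : i != j.
    by apply: contraTneq eij => ->; have [_ -> _] := graph_e.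
  by rewrite !mxE oppr_lt0 (negPf ij) mulr0n addr0 Bpos.
- by rewrite mulNmx Az.
- move=> i; case: (split_ordP i) => j ->.
    by rewrite [X in 0 <= X]mxE col_mxEu mxE oppr0.
  rewrite [X in 0 <= X]mxE col_mxEd diagv_mulE -mulNr.
  apply: mulr_ge0; last exact/ltW/Estar_gt0.
  by rewrite oppr_ge0; exact/ltW/K_lt0.
- rewrite [X in 0 < X]mxE col_mxEd diagv_mulE -mulNr.
  by rewrite mulr_gt0 ?oppr_gt0 ?K_lt0 ?Estar_gt0.
Qed.

End GridPositivity.

(** * Sup norm and convergence of matrices *)

Section MatrixNorm.
Context {R : realType}.
Local Open Scope classical_set_scope.

Lemma mx_norm_leP p q (M : 'M[R]_(p, q)) c : 0 <= c ->
  (forall i j, `|M i j| <= c) -> `|M| <= c.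
Proof.
move=> c0 Mc; rewrite [leLHS]mx_normrE.
by apply/bigmax_leP; split=> // -[i j] _; exact: Mc.
Qed.

Lemma mx_subE p q (M N : 'M[R]_(p, q)) i j : (M - N) i j = M i j - N i j.
Proof. by rewrite !mxE. Qed.

Lemma coord_le_mx_norm p q (M : 'M[R]_(p, q)) i j : `|M i j| <= `|M|.
Proof.
rewrite [leRHS]mx_normrE.
by apply/bigmax_geP; right => /=; exists (i, j).
Qed.

Lemma cvg_mx T (F : set_system T) (FF : Filter F) p q (f : T -> 'M[R]_(p, q))
    (l : 'M[R]_(p, q)) :
  (forall i j, f x i j @[x --> F] --> l i j) -> f @ F --> l.
Proof.
move=> fl; apply/cvgrPdist_le => eps eps0.
have : \forall x \near F, forall i j, `|l i j - f x i j| <= eps.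
  apply: filter_forall => i; apply: filter_forall => j.
  by move/cvgrPdist_le: (fl i j); exact.
apply: filterS => x lf; apply: mx_norm_leP; first exact: ltW.
by move=> i j; rewrite !mxE.
Qed.

Lemma mulmx_norm_le p q (M : 'M[R]_(p, q)) (v : 'cV[R]_q) :
  `|M *m v| <= (\sum_i \sum_j `|M i j|) * `|v|.
Proof.
apply: mx_norm_leP => [|i j].
  by rewrite mulr_ge0 // sumr_ge0 // => i _; rewrite sumr_ge0.
rewrite mxE (le_trans (ler_norm_sum _ _ _)) // ord1.
apply: (@le_trans _ _ ((\sum_j `|M i j|) * `|v|)).
  rewrite mulr_suml; apply: ler_sum => l _.
  by rewrite normrM ler_wpM2l // coord_le_mx_norm.
rewrite ler_wpM2r // (bigD1 i) //= lerDl.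
by apply: sumr_ge0 => l _; apply: sumr_ge0.
Qed.

End MatrixNorm.

(** * Differential inequalities and primitives *)

Section Comparison.
Context {R : realType}.
Local Open Scope classical_set_scope.

Lemma derive_nonincr (f df : R -> R) T : 0 <= T ->
  {within `[0, T], continuous f} ->
  (forall t, 0 < t < T -> is_derive t 1 f (df t)) ->
  (forall t, 0 < t < T -> df t <= 0) -> f T <= f 0.
Proof.
rewrite le_eqVlt => /predU1P[<-//|T0] fc fd df0.
have fd' x : x \in `]0, T[%R -> is_derive x 1 f (df x).
  by rewrite in_itv /=; exact: fd.
have [c cT] := MVT T0 fd' fc.
move: cT; rewrite in_itv /= => cT E.
by rewrite -subr_le0 E subr0 mulr_le0_ge0 ?df0 ?ltW.
Qed.

Lemma is_derive_exp_scale (k t : R) :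
  is_derive t 1 (fun s => expR (k * s)) (k * expR (k * t)).
Proof.
have h : is_derive t 1 (fun s : R => k * s) k.
  have := @is_deriveZ _ _ _ id k t 1 1 (is_derive_id _ _).
  by rewrite /GRing.scale /= mulr1.
by rewrite mulrC; apply: (@is_derive1_comp _ expR (fun s => k * s)).
Qed.

(** Gronwall: exp(-k t) W(t) is nonincreasing. *)
Lemma gronwall (W dW : R -> R) k T : 0 <= T ->
  {within `[0, T], continuous W} ->
  (forall t, 0 < t < T -> is_derive t 1 W (dW t)) ->
  (forall t, 0 < t < T -> dW t <= k * W t) ->
  W T <= expR (k * T) * W 0.
Proof.
move=> T0 Wc Wd dWk.
pose f t := expR (- k * t) * W t.
pose df t := expR (- k * t) * dW t + W t * (- k * expR (- k * t)).
have : f T <= f 0.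
  apply: (@derive_nonincr f df) => //.
  - have ec : {within `[0, T], continuous (fun t : R => expR (- k * t))}.
      apply: continuous_subspaceT => x.
      have := is_derive_exp_scale (- k) x.
      by move=> [/derivable1_diffP/differentiable_continuous].
    by move=> x; exact: (cvgM (ec x) (Wc x)).
  - move=> t tT; have := is_deriveM (is_derive_exp_scale (- k) t) (Wd t tT).
    exact.
  - move=> t tT; rewrite /df mulrC.
    have -> : dW t * expR (- k * t) + W t * (- k * expR (- k * t)) =
      expR (- k * t) * (dW t - k * W t) by ring.
    by rewrite pmulr_rle0 ?expR_gt0 // subr_le0 dWk.
rewrite /f mulr0 expR0 mul1r => h.
have := ler_wpM2l (expR_ge0 (k * T)) h.
by rewrite mulrA -expRD mulNr subrr expR0 mul1r.
Qed.

(** The integral from 0 of C L exp(L t) is at most C exp(L t): measured with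
    this weight, integration is a division by L. *)
Lemma exp_domination (w dw : R -> R) (L C : R) : 0 < L -> 0 <= C -> w 0 = 0 ->
  (forall t : R, 0 <= t -> is_derive t 1 w (dw t)) ->
  (forall t : R, 0 <= t -> `|dw t| <= C * (L * expR (L * t))) ->
  forall t : R, 0 <= t -> `|w t| <= C * expR (L * t).
Proof.
move=> L0 C0 w0 wd dwC T T0.
have gd (t : R) : is_derive t 1 (fun s : R => C * expR (L * s)) (C * (L * expR (L * t))).
  exact: (is_deriveZ C (is_derive_exp_scale L t)).
have cont (f df : R -> R) : (forall t : R, 0 <= t -> is_derive t 1 f (df t)) ->
    {within `[0, T], continuous f}.
  move=> fd; apply: derivable_within_continuous => t; rewrite in_itv /=.
  by move=> /andP[/fd[]].
rewrite ler_norml; apply/andP; split.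
  have hd (t : R) : 0 <= t -> is_derive t 1 (fun s => - w s - C * expR (L * s))
      (- dw t - C * (L * expR (L * t))).
    move=> t0; have := is_deriveB (is_deriveN (wd t t0)) (gd t); exact.
  have := @derive_nonincr _ _ T T0 (cont _ _ hd)
    (fun t tT => hd t (ltW (andP tT).1)).
  have h (t : R) : 0 < t < T -> - dw t - C * (L * expR (L * t)) <= 0.
    by move=> /andP[/ltW/dwC + _]; rewrite ler_norml => /andP[]; lra.
  by move/(_ h); rewrite w0 mulr0 expR0; lra.
have hd (t : R) : 0 <= t -> is_derive t 1 (fun s => w s - C * expR (L * s))
    (dw t - C * (L * expR (L * t))).
  move=> t0; have := is_deriveB (wd t t0) (gd t); exact.
have := @derive_nonincr _ _ T T0 (cont _ _ hd)
  (fun t tT => hd t (ltW (andP tT).1)).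
have h (t : R) : 0 < t < T -> dw t - C * (L * expR (L * t)) <= 0.
  by move=> /andP[/ltW/dwC + _]; rewrite ler_norml => /andP[]; lra.
by move/(_ h); rewrite w0 mulr0 expR0; lra.
Qed.

(** The integral starts at -1 rather than at 0 so that 0 is interior to the
    domain and the derivative there is two-sided. *)
Definition primitive (f : R -> R) (t : R) : R :=
  (\int[lebesgue_measure]_(s in `[(-1 : R), t]) f s)%R
  - (\int[lebesgue_measure]_(s in `[(-1 : R), 0%R]) f s)%R.

Lemma primitive0 f : primitive f 0 = 0.
Proof. exact: subrr. Qed.

Lemma is_derive_primitive (f : R -> R) (t : R) : continuous f -> -1 < t ->
  is_derive t 1 (primitive f) (f t).
Proof.
move=> fc t1.
have fi : lebesgue_measure.-integrable `[(-1 : R), t + 1] (EFin \o f).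
  apply: continuous_compact_integrable; first exact: segment_compact.
  exact: continuous_subspaceT.
have tt1 : t < t + 1 by rewrite ltrDl.
have [Fd FE] := continuous_FTC1_closed tt1 fi t1 (fc t).
have h : is_derive t 1
    (fun y => (\int[lebesgue_measure]_(s in `[(-1 : R), y]) f s)%R) (f t).
  by apply: DeriveDef => //; rewrite -derive1E.
have := is_deriveB h (is_derive_cst
  (\int[lebesgue_measure]_(s in `[(-1 : R), 0%R]) f s)%R t 1).
by rewrite subr0.
Qed.

Lemma half_pow_lt (c eps : R) : 0 < eps -> exists k, c * 2^-1 ^+ k < eps.
Proof.
move=> eps0; exists (Num.bound (c / eps)).
have := @upper_nthrootP _ (c / eps) _ (leqnn _).
by rewrite exprVn ltr_pdivrMr // => h; rewrite ltr_pdivrMr ?exprn_gt0 // mulrC.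
Qed.

(** The sequences x k - 2 c / 2^k and x k + 2 c / 2^k are monotone and enclose
    the limit, which gives the rate of convergence at once. *)
Lemma geometric_limit (x : nat -> R) c :
  (forall k, `|x k.+1 - x k| <= c * 2^-1 ^+ k) ->
  exists l, forall k, `|x k - l| <= 2 * c * 2^-1 ^+ k.
Proof.
move=> xc.
pose a k := x k - 2 * c * 2^-1 ^+ k; pose b k := x k + 2 * c * 2^-1 ^+ k.
have c0 k : 0 <= c * 2^-1 ^+ k by exact: le_trans (xc k).
have aS k : a k <= a k.+1.
  by have := xc k; rewrite /a ler_norml exprS; lra.
have bS k : b k.+1 <= b k.
  by have := xc k; rewrite /b ler_norml exprS; lra.
have amono : {homo a : i j / (i <= j)%N >-> i <= j}.
  exact: homo_leq (@lexx _ _) (@le_trans _ _) aS.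
have bmono : {homo b : i j / (i <= j)%N >-> j <= i}.
  by apply: homo_leq bS => // ? ? ? /[swap]; exact: le_trans.
have ab i j : a i <= b j.
  apply: (le_trans (amono _ _ (leq_maxl i j))).
  apply: le_trans (bmono _ _ (leq_maxr i j)).
  by rewrite /a /b; have := c0 (maxn i j); lra.
have A0 : range a !=set0 by exists (a 0%N), 0%N.
have Aub k : ubound (range a) (b k) by move=> _ [i _ <-].
exists (sup (range a)) => k; rewrite distrC ler_norml; apply/andP; split.
  have : a k <= sup (range a).
    by apply: ub_le_sup; [exists (b 0%N); exact: Aub|exists k].
  by rewrite /a; lra.
have : sup (range a) <= b k by apply: ge_sup => //; exact: Aub.
by rewrite /b; lra.
Qed.

End Comparison.

(** * Global solutions for a Lipschitz field *)

Section Picard.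
Context {R : realType} {m : nat}.
Local Open Scope classical_set_scope.
Variables (g : 'cV[R]_m -> 'cV[R]_m) (L : R) (x0 : 'cV[R]_m).
Hypotheses (L_gt0 : 0 < L) (g_lip : forall x y, `|g x - g y| <= L * `|x - y|).

Lemma lipschitz_comp_continuous (v : R -> 'cV[R]_m) i :
  continuous v -> continuous (fun s => g (v s) i 0).
Proof.
move=> vc t; apply/cvgrPdist_le => eps eps0.
move/cvgrPdist_le: (vc t) => /(_ (eps / L)); rewrite divr_gt0 // => /(_ isT).
apply: filterS => s vs.
have := coord_le_mx_norm (g (v t) - g (v s)) i 0; rewrite mx_subE => /le_trans; apply.
by rewrite (le_trans (g_lip _ _)) // mulrC -ler_pdivlMr.
Qed.

Definition integral_path (v : R -> 'cV[R]_m) (t : R) : 'cV[R]_m :=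
  x0 + \col_i primitive (fun s => g (v s) i 0) t.

(** Paths are continued evenly to negative times, so that all the functions
    to integrate are continuous on the whole line. *)
Definition picard (v : R -> 'cV[R]_m) (t : R) : 'cV[R]_m :=
  integral_path v `|t|.

Lemma is_derive_integral_path (v : R -> 'cV[R]_m) i (t : R) : continuous v -> -1 < t ->
  is_derive t 1 (fun s => integral_path v s i 0) (g (v t) i 0).
Proof.
move=> vc t1.
have -> : (fun s => integral_path v s i 0) =
    cst (x0 i 0) + primitive (fun s => g (v s) i 0).
  by apply/funext => s; rewrite !mxE.
rewrite -[g (v t) i 0]add0r; apply: is_deriveD.
exact: (is_derive_primitive (lipschitz_comp_continuous vc) t1).
Qed.

Lemma picard_continuous (v : R -> 'cV[R]_m) : continuous v -> continuous (picard v).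
Proof.
move=> vc t; apply: cvg_mx => i j; rewrite ord1.
have t1 : -1 < `|t| by rewrite (lt_le_trans _ (normr_ge0 _)) // ltrN10.
have [/derivable1_diffP/differentiable_continuous h _] :=
  is_derive_integral_path i vc t1.
exact: (continuous_comp (@norm_continuous _ _ t) h).
Qed.

(** The weight exp(2 L t) makes the Picard operator contract by a factor 2 on
    the whole half-line. *)
Lemma picard_contract (v w : R -> 'cV[R]_m) (C : R) : continuous v -> continuous w -> 0 <= C ->
  (forall t : R, 0 <= t -> `|v t - w t| <= C * expR (2 * L * t)) ->
  forall t : R, 0 <= t ->
    `|picard v t - picard w t| <= C / 2 * expR (2 * L * t).
Proof.
move=> vc wc C0 vw t t0.
apply: mx_norm_leP => [|i j]; first by rewrite mulr_ge0 ?expR_ge0 ?divr_ge0.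
rewrite ord1 /picard (ger0_norm t0) mx_subE.
apply: (exp_domination (dw := fun t => g (v t) i 0 - g (w t) i 0)
  (w := fun t => integral_path v t i 0 - integral_path w t i 0)) => //.
- by rewrite mulr_gt0.
- by rewrite divr_ge0.
- by rewrite !mxE !primitive0 subrr.
- move=> s s0; have s1 : -1 < s by rewrite (lt_le_trans _ s0) // ltrN10.
  exact: (is_deriveB (is_derive_integral_path i vc s1)
    (is_derive_integral_path i wc s1)).
- move=> s s0; have := coord_le_mx_norm (g (v s) - g (w s)) i 0.
  rewrite mx_subE => /le_trans; apply; apply: le_trans (g_lip _ _) _.
  have := ler_wpM2l (ltW L_gt0) (vw s s0).
  by rewrite (_ : C / 2 * _ = L * (C * expR (2 * L * s))) //; field.
Qed.

Definition picard_iter k : R -> 'cV[R]_m := iter k picard (fun=> x0).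

Lemma picard_iter_continuous k : continuous (picard_iter k).
Proof.
elim: k => [|k IH]; first by move=> t; exact: cvg_cst.
exact: picard_continuous.
Qed.

Lemma picard_iter_norm k (t : R) : picard_iter k `|t| = picard_iter k t.
Proof. by case: k => //= k; rewrite /picard normr_id. Qed.

(** The constant is what bounds the first step: the constant field g x0 is at
    most C (2 L) exp(2 L t) in norm. *)
Lemma picard_iter_step : exists2 C : R, 0 <= C &
  forall k (t : R), 0 <= t ->
    `|picard_iter k.+1 t - picard_iter k t|
      <= C * 2^-1 ^+ k * expR (2 * L * t).
Proof.
exists (`|g x0| / (2 * L)) => [|k].
  by rewrite divr_ge0 // mulr_ge0 // ltW.
have C0 : 0 <= `|g x0| / (2 * L) by rewrite divr_ge0 // mulr_ge0 // ltW.
elim: k => [|k IH] t t0; last first.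
  rewrite exprS mulrCA [2^-1 * _]mulrC.
  apply: picard_contract IH _ t0; try exact: picard_iter_continuous.
  by rewrite mulr_ge0 // exprn_ge0.
rewrite expr0 mulr1; apply: mx_norm_leP => [|i j].
  by rewrite mulr_ge0 ?expR_ge0.
rewrite ord1 /= /picard (ger0_norm t0) mx_subE.
have xc : continuous ((fun=> x0) : R -> 'cV[R]_m).
  by move=> s; exact: cvg_cst.
apply: (exp_domination (dw := fun=> g x0 i 0 - 0)
  (w := fun t => integral_path (fun=> x0) t i 0 - x0 i 0)) => //.
- by rewrite mulr_gt0.
- by rewrite !mxE primitive0 addr0 subrr.
- move=> s s0; have s1 : -1 < s by rewrite (lt_le_trans _ s0) // ltrN10.
  exact: (is_deriveB (is_derive_integral_path i xc s1) (is_derive_cst _ _ _)).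
- move=> s s0; rewrite subr0 (le_trans (coord_le_mx_norm _ i 0)) //.
  rewrite mulrA divfK ?mulf_neq0 ?gt_eqF // ler_peMr // -expR0 ler_expR.
  by rewrite mulr_ge0 // mulr_ge0 // ltW.
Qed.

(** Global Picard-Lindelof theorem.  The iterates converge at each time at the
    rate exp(2 L t) / 2^k, hence locally uniformly; the limit is continuous and
    is a fixed point of the contraction. *)
Lemma lipschitz_flow : exists u : R -> 'cV[R]_m, u 0 = x0 /\
  forall t : R, 0 <= t -> forall i,
    is_derive t 1 (fun s => u s i 0) (g (u t) i 0).
Proof.
have [C C0 step] := picard_iter_step.
have lim_coord (t : R) i : {l : R | forall k, `|picard_iter k `|t| i 0 - l| <=
    2 * (C * expR (2 * L * `|t|)) * 2^-1 ^+ k}.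
  apply/cid/geometric_limit => k.
  have := step k `|t| (normr_ge0 t); rewrite mulrAC; apply: le_trans.
  have := coord_le_mx_norm (picard_iter k.+1 `|t| - picard_iter k `|t|) i 0.
  by rewrite mx_subE.
pose v t : 'cV[R]_m := \col_i sval (lim_coord t i).
have vlim k (t : R) : `|picard_iter k t - v t| <=
    2 * C * 2^-1 ^+ k * expR (2 * L * `|t|).
  apply: mx_norm_leP => [|i j].
    by rewrite mulr_ge0 ?expR_ge0 // mulr_ge0 ?exprn_ge0 // mulr_ge0.
  rewrite ord1 -picard_iter_norm mx_subE [v t i 0]mxE.
  case: (lim_coord t i) => l /= /(_ k) /le_trans; apply.
  by rewrite le_eqVlt; apply/orP; left; apply/eqP; ring.
have vc : continuous v.
  move=> t; apply/cvgrPdist_le => eps eps0.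
  pose M := expR (2 * L * (`|t| + 1)).
  have [k kM] := half_pow_lt (2 * C * M) (divr_gt0 eps0 (ltr0n R 3)).
  have near_v (s : R) : `|s| <= `|t| + 1 -> `|picard_iter k s - v s| <= eps / 3.
    move=> st; apply: le_trans (vlim k s) (le_trans _ (ltW kM)).
    rewrite mulrAC ler_wpM2r ?exprn_ge0 // ler_wpM2l ?mulr_ge0 //.
    by rewrite ler_expR ler_wpM2l // mulr_ge0 // ltW.
  have e3 : 0 < eps / 3 by rewrite divr_gt0.
  move/cvgrPdist_le: (@picard_iter_continuous k t) => /(_ _ e3) near_pk.
  have near1 : \forall s \near t, `|s - t| <= 1.
    have := @cvg_id _ (nbhs t); move/cvgrPdist_le => /(_ 1 ltr01).
    by apply: filterS => s; rewrite distrC.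
  near=> s.
  have -> : v t - v s = - (picard_iter k t - v t) +
      (picard_iter k t - picard_iter k s) + (picard_iter k s - v s).
    by rewrite opprB !addrA !subrK.
  rewrite (le_trans (ler_normD _ _)) //.
  have -> : eps = eps / 3 + eps / 3 + eps / 3 by field.
  apply: lerD; last first.
    apply: near_v; rewrite -[s in leLHS](subrK t) addrC.
    rewrite (le_trans (ler_normD _ _)) // lerD2l.
    by near: s.
  rewrite (le_trans (ler_normD _ _)) // lerD //.
    by rewrite normrN near_v // lerDl.
  by near: s.
have fixed (t : R) : 0 <= t -> integral_path v t = v t.
  move=> t0; apply/eqP; rewrite -subr_eq0 -normr_eq0 eq_le normr_ge0 andbT.
  apply/ler_addgt0Pl => eps eps0; rewrite addr0.
  have [k kM] := half_pow_lt (2 * C * expR (2 * L * t)) eps0.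
  apply: le_trans (ltW kM).
  have h1 : `|picard (picard_iter k) t - picard v t| <=
      2 * C * 2^-1 ^+ k / 2 * expR (2 * L * t).
    apply: picard_contract => //; first exact: picard_iter_continuous.
      by rewrite mulr_ge0 ?exprn_ge0 // mulr_ge0.
    by move=> s s0; have := vlim k s; rewrite (ger0_norm s0).
  have := vlim k.+1 t; rewrite (ger0_norm t0) => h2.
  have -> : integral_path v t - v t =
      - (picard (picard_iter k) t - picard v t) + (picard_iter k.+1 t - v t).
    by rewrite opprB /= /picard (ger0_norm t0) addrA subrK.
  rewrite (le_trans (ler_normD _ _)) // normrN.
  apply: le_trans (lerD h1 h2) _.
  by rewrite exprS le_eqVlt; apply/orP; left; apply/eqP; field.
exists (integral_path v); split.
  by apply/colP => i; rewrite !mxE primitive0 addr0.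
move=> t t0 i; rewrite fixed //; apply: is_derive_integral_path => //.
by rewrite (lt_le_trans _ t0) // ltrN10.
Unshelve. all: by end_near. Qed.

End Picard.

(** * Norm estimates for positive definite forms *)

Section NormBounds.
Context {R : realType}.

Lemma sqr_norm_le_sum m (x : 'cV[R]_m) : `|x| ^+ 2 <= \sum_i x i 0 ^+ 2.
Proof.
have S0 : 0 <= \sum_i x i 0 ^+ 2 by apply: sumr_ge0 => i _; exact: sqr_ge0.
rewrite -(sqr_sqrtr S0) ler_pXn2r ?nnegrE ?sqrtr_ge0 //.
apply: mx_norm_leP => [|i j]; first exact: sqrtr_ge0.
rewrite ord1 -sqrtr_sqr ler_wsqrtr // (bigD1 i) //= lerDl.
by apply: sumr_ge0 => l _; exact: sqr_ge0.
Qed.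

Lemma sum_le_sqr_norm m (x : 'cV[R]_m) :
  \sum_i x i 0 ^+ 2 <= m%:R * `|x| ^+ 2.
Proof.
have -> : m%:R * `|x| ^+ 2 = \sum_(i < m) `|x| ^+ 2.
  by rewrite sumr_const card_ord mulr_natl.
apply: ler_sum => i _.
rewrite -real_normK ?num_real // ler_pXn2r ?nnegrE //.
exact: coord_le_mx_norm.
Qed.

(** The reciprocal of 1 + sup norm of the inverses avoids a minimum over a
    possibly empty index set. *)
Lemma positive_vec_lb m (z : 'cV[R]_m) : positive_vec z ->
  exists2 z0 : R, 0 < z0 & forall i, z0 <= z i 0.
Proof.
move=> zpos; pose w : 'cV[R]_m := \col_i (z i 0)^-1.
have w1 : 0 < `|w| + 1 by rewrite ltr_wpDl.
exists (`|w| + 1)^-1 => [|i]; first by rewrite invr_gt0.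
rewrite -[leRHS]invrK lef_pV2 ?posrE ?invr_gt0 //.
have := coord_le_mx_norm w i 0; rewrite mxE => /(le_trans (ler_norm _)).
by move=> /le_trans; apply; rewrite lerDl.
Qed.

Lemma posdef_lower m (Q : 'M[R]_m) : Q^T = Q -> posdef Q ->
  exists2 a : R, 0 < a & forall x, `|x| ^+ 2 <= a * qform Q x.
Proof.
move=> Qsym Qpos; exists (\sum_i `|invmx Q i i| + 1) => [|x].
  by rewrite ltr_wpDl // sumr_ge0.
have q0 : 0 <= qform Q x := posdef_ge0 x Qpos.
apply: le_trans (sqr_norm_le_sum x) _.
apply: (@le_trans _ _ (\sum_i `|invmx Q i i| * qform Q x)).
  apply: ler_sum => i _; apply: le_trans (posdef_coord_le x i Qsym Qpos) _.
  by rewrite ler_wpM2r // ler_norm.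
by rewrite -mulr_suml ler_wpM2r // lerDl.
Qed.

Lemma posdef_upper m (Q : 'M[R]_m) :
  exists2 b : R, 0 < b & forall x, qform Q x <= b * `|x| ^+ 2.
Proof.
have S0 : 0 <= \sum_i \sum_j `|Q i j|.
  by apply: sumr_ge0 => i _; exact: sumr_ge0.
exists ((\sum_i \sum_j `|Q i j|) * m%:R + 1) => [|x].
  by rewrite ltr_wpDl // mulr_ge0.
apply: le_trans (qform_le Q x) _.
apply: le_trans (ler_wpM2l S0 (sum_le_sqr_norm x)) _.
by rewrite mulrA ler_wpM2r ?exprn_ge0 // lerDl.
Qed.

(** Q is the gradient of half its form, so this is the Polyak-Lojasiewicz
    inequality of a strongly convex quadratic; it turns the dissipation into
    exponential decay. *)
Lemma posdef_gradient m (Q : 'M[R]_m) : Q^T = Q -> posdef Q ->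
  exists2 C : R, 0 < C &
    forall x, qform Q x <= C * \sum_i (Q *m x) i 0 ^+ 2.
Proof.
move=> Qsym Qpos; have Qu := posdef_unitmx Qpos.
have S0 : 0 <= \sum_i \sum_j `|invmx Q i j|.
  by apply: sumr_ge0 => i _; exact: sumr_ge0.
exists (\sum_i \sum_j `|invmx Q i j| + 1) => [|x]; first by rewrite ltr_wpDl.
have -> : qform Q x = qform (invmx Q) (Q *m x).
  by rewrite /qform trmx_mul Qsym -!mulmxA mulKmx.
apply: le_trans (qform_le _ _) _; rewrite ler_wpM2r ?lerDl //.
by apply: sumr_ge0 => i _; exact: sqr_ge0.
Qed.

End NormBounds.

(** * Uniqueness of solutions *)

Section Uniqueness.
Context {R : realType} {m : nat}.
Local Open Scope classical_set_scope.

Lemma is_derive_sum_fun k (h : 'I_k -> R -> R) (dh : 'I_k -> R) (t : R) :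
  (forall i, is_derive t 1 (h i) (dh i)) ->
  is_derive t 1 (fun s => \sum_i h i s) (\sum_i dh i).
Proof.
move=> hd; have -> : (fun s => \sum_i h i s) = \sum_i h i.
  by apply/funext => s; rewrite fct_sumE.
exact: is_derive_sum.
Qed.

Lemma within_continuous_sum k (A : set R) (h : 'I_k -> R -> R) :
  (forall i, {within A, continuous (h i)}) ->
  {within A, continuous (fun s => \sum_i h i s)}.
Proof.
move=> hc; apply: (@continuous_big R 'I_k +%R 0 xpredT _ (subspace A)).
  by move=> x; apply: cvgD; [exact: cvg_fst|exact: cvg_snd].
by move=> i _; exact: hc.
Qed.

(** The squared distance of the two solutions satisfies Gronwall's inequality
    and starts at 0. *)
Lemma ode_unique (g : 'cV[R]_m -> 'cV[R]_m) (P : 'cV[R]_m -> Prop) (L T : R)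
    (u v : R -> 'cV[R]_m) :
  0 <= L -> 0 <= T ->
  (forall x y, P x -> P y -> `|g x - g y| <= L * `|x - y|) ->
  (forall i, {within `[0, T], continuous (fun s => u s i 0)}) ->
  (forall i, {within `[0, T], continuous (fun s => v s i 0)}) ->
  (forall t : R, 0 < t < T -> P (u t) /\ P (v t)) ->
  (forall t : R, 0 < t < T -> forall i,
     is_derive t 1 (fun s => u s i 0) (g (u t) i 0)) ->
  (forall t : R, 0 < t < T -> forall i,
     is_derive t 1 (fun s => v s i 0) (g (v t) i 0)) ->
  u 0 = v 0 -> u T = v T.
Proof.
move=> L0 T0 glip uc vc Puv ud vd uv0.
pose d i (s : R) := u s i 0 - v s i 0.
pose dd i (s : R) := g (u s) i 0 - g (v s) i 0.
pose W (s : R) := \sum_i d i s * d i s.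
pose dW (s : R) := \sum_i (d i s * dd i s + d i s * dd i s).
have W0 : W 0 = 0 by apply: big1 => i _; rewrite /d uv0 subrr mulr0.
have dnorm s : `|u s - v s| ^+ 2 <= W s.
  apply: le_trans (sqr_norm_le_sum _) _; apply: ler_sum => i _.
  by rewrite mx_subE expr2.
have : W T <= expR (2 * L * m%:R * T) * W 0.
  apply: (gronwall (dW := dW)) => //.
  - apply: within_continuous_sum => i x.
    exact: (cvgM (cvgB (uc i x) (vc i x)) (cvgB (uc i x) (vc i x))).
  - move=> t tT; apply: is_derive_sum_fun => i.
    have h := is_deriveB (ud t tT i) (vd t tT i).
    exact: (is_deriveM h h).
  - move=> t tT; have [Pu Pv] := Puv t tT.
    apply: (@le_trans _ _ (\sum_(i < m) 2 * L * W t)); last first.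
      have -> : 2 * L * m%:R * W t = (2 * L * W t) *+ m.
        by rewrite -[RHS]mulr_natr; ring.
      by rewrite sumr_const card_ord.
    apply: ler_sum => i _.
    have di : `|d i t| <= `|u t - v t|.
      by have := coord_le_mx_norm (u t - v t) i 0; rewrite mx_subE.
    have ddi : `|dd i t| <= L * `|u t - v t|.
      apply: le_trans (glip _ _ Pu Pv).
      by have := coord_le_mx_norm (g (u t) - g (v t)) i 0; rewrite mx_subE.
    have := ler_pM (normr_ge0 _) (normr_ge0 _) di ddi; rewrite -normrM => h.
    have := ler_wpM2l L0 (dnorm t); rewrite expr2 => h2.
    have := ler_norm (d i t * dd i t); move: h h2; lra.
rewrite W0 mulr0 => WT.
apply/eqP; rewrite -subr_eq0 -normr_eq0 -sqrf_eq0 eq_le sqr_ge0 andbT.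
exact: le_trans (dnorm T) WT.
Qed.

End Uniqueness.

(** * Radial retraction *)

Lemma max_dist (R : realType) (r a b : R) :
  `|Num.max r a - Num.max r b| <= `|a - b|.
Proof.
have h1 := ler_norm (a - b); have h2 := ler_norm (b - a).
rewrite distrC in h2; rewrite ler_norml !maxEle.
by case: (leP r a) => ha; case: (leP r b) => hb; apply/andP; split; lra.
Qed.

Section Retraction.
Context {R : realType} {m : nat}.
Variable r : R.
Hypothesis r_gt0 : 0 < r.
Implicit Types x y : 'cV[R]_m.

(** Radial retraction onto the ball of radius r.  Unlike a coordinatewise
    truncation, it maps x to a positive multiple of x, so that it commutes with
    linear maps up to a positive factor. *)
Definition shrink x : R := r / Num.max r `|x|.

Definition retract x : 'cV[R]_m := shrink x *: x.

Lemma shrink_gt0 x : 0 < shrink x.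
Proof. by rewrite divr_gt0 // lt_max r_gt0. Qed.

Lemma retract_id x : `|x| <= r -> retract x = x.
Proof.
by move=> xr; rewrite /retract /shrink max_l // divff ?gt_eqF // scale1r.
Qed.

Lemma retract_norm x : `|retract x| <= r.
Proof.
rewrite normrZ gtr0_norm ?shrink_gt0 // /shrink mulrAC.
by rewrite ler_pdivrMr ?lt_max ?r_gt0 // ler_pM2l // le_max lexx orbT.
Qed.

Lemma retract_lip x y : `|retract x - retract y| <= 2 * `|x - y|.
Proof.
have mx_gt0 (z : 'cV[R]_m) : 0 < Num.max r `|z| by rewrite lt_max r_gt0.
have -> : retract x - retract y =
    shrink x *: (x - y) + (shrink x - shrink y) *: y.
  by rewrite /retract scalerBr scalerBl addrA subrK.
rewrite (le_trans (ler_normD _ _)) // (normrZ (shrink x)).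
rewrite (normrZ (_ - _)) mulr_natl mulr2n; apply: lerD.
  rewrite (gtr0_norm (shrink_gt0 x)); apply: ler_piMl => //; rewrite /shrink.
  by rewrite ler_pdivrMr // mul1r le_max lexx.
have maxd : `|Num.max r `|y| - Num.max r `|x| | <= `|x - y|.
  rewrite (le_trans (max_dist _ _ _)) // distrC; exact: ler_dist_dist.
have -> : shrink x - shrink y =
    r * (Num.max r `|y| - Num.max r `|x|) / (Num.max r `|x| * Num.max r `|y|).
  by rewrite /shrink; field; rewrite !gt_eqF.
have rx : r <= Num.max r `|x| by rewrite le_max lexx.
have yy : `|y| <= Num.max r `|y| by rewrite le_max lexx orbT.
rewrite !normrM normfV normrM (gtr0_norm r_gt0) !(gtr0_norm (mx_gt0 _)).
move: (mx_gt0 x) (mx_gt0 y) rx yy maxd.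
set a := Num.max r `|x|; set b := Num.max r `|y| => a0 b0 ra yb ab.
have -> : r * `|b - a| / (a * b) * `|y| =
    (r * (`|b - a| * `|y|)) / (a * b) by ring.
rewrite ler_pdivrMr ?mulr_gt0 // [leRHS]mulrCA.
apply: ler_pM; [exact: ltW|by rewrite mulr_ge0|exact: ra|exact: ler_pM].
Qed.

End Retraction.

(** * Decay for the reduced equation *)

Section Lotka.
Context {R : realType} {m : nat}.
Local Open Scope classical_set_scope.
Variables (Q : 'M[R]_m) (z tau : 'cV[R]_m).

(** The Lotka-Volterra field obtained by eliminating the algebraic variables,
    with u the deviation from the equilibrium z. *)
Definition lotka (u : 'cV[R]_m) : 'cV[R]_m :=
  \col_i (- (tau i 0)^-1 * (z i 0 + u i 0) * (Q *m u) i 0).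

Lemma lotka_lip (r : R) : 0 <= r -> exists2 L : R, 0 <= L &
  forall x y, `|x| <= r -> `|y| <= r ->
    `|lotka x - lotka y| <= L * `|x - y|.
Proof.
move=> r0; pose th : 'cV[R]_m := \col_i (tau i 0)^-1.
pose q := \sum_i \sum_j `|Q i j|.
have q0 : 0 <= q by apply: sumr_ge0 => i _; exact: sumr_ge0.
exists (`|th| * ((`|z| + r) * q + q * r)) => [|x y xr yr].
  by rewrite mulr_ge0 // addr_ge0 // mulr_ge0 // addr_ge0.
apply: mx_norm_leP => [|i j].
  by rewrite mulr_ge0 // mulr_ge0 // addr_ge0 // mulr_ge0 // addr_ge0.
rewrite ord1 mx_subE !mxE -!/(mulmx _ _).
have mulE (v : 'cV[R]_m) : \sum_j Q i j * v j 0 = (Q *m v) i 0 by rewrite mxE.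
rewrite !mulE.
have -> : - (tau i 0)^-1 * (z i 0 + x i 0) * (Q *m x) i 0 -
    - (tau i 0)^-1 * (z i 0 + y i 0) * (Q *m y) i 0 =
  - (tau i 0)^-1 * ((z i 0 + x i 0) * (Q *m (x - y)) i 0
    + (x i 0 - y i 0) * (Q *m y) i 0).
  by rewrite mulmxBr mx_subE; ring.
have thi : `|(tau i 0)^-1| <= `|th|.
  by have := coord_le_mx_norm th i 0; rewrite mxE.
have zx : `|z i 0 + x i 0| <= `|z| + r.
  apply: le_trans (ler_normD _ _) (lerD (coord_le_mx_norm z i 0) _).
  exact: le_trans (coord_le_mx_norm x i 0) xr.
have xy : `|x i 0 - y i 0| <= `|x - y|.
  by have := coord_le_mx_norm (x - y) i 0; rewrite mx_subE.
have Qxy : `|(Q *m (x - y)) i 0| <= q * `|x - y|.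
  exact: le_trans (coord_le_mx_norm _ i 0) (mulmx_norm_le _ _).
have Qy : `|(Q *m y) i 0| <= q * r.
  apply: le_trans (coord_le_mx_norm _ i 0) (le_trans (mulmx_norm_le _ _) _).
  exact: ler_wpM2l.
rewrite normrM normrN -mulrA; apply: ler_pM => //.
rewrite (le_trans (ler_normD _ _)) // !normrM mulrDl -mulrA; apply: lerD.
  exact: ler_pM.
by rewrite [leRHS]mulrC; apply: ler_pM.
Qed.

Hypotheses (Qsym : Q^T = Q) (Qpos : posdef Q) (tau_gt0 : positive_vec tau).

Lemma is_derive_qform (u : R -> 'cV[R]_m) (du : 'cV[R]_m) (t : R) :
  (forall i, is_derive t 1 (fun s => u s i 0) (du i 0)) ->
  is_derive t 1 (fun s => qform Q (u s))
    (2 * \sum_i du i 0 * (Q *m u t) i 0).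
Proof.
move=> ud.
have Qd i : is_derive t 1 (fun s => (Q *m u s) i 0) ((Q *m du) i 0).
  have -> : (fun s => (Q *m u s) i 0) = (fun s => \sum_j Q i j * u s j 0).
    by apply/funext => s; rewrite mxE.
  have h j := is_deriveZ (Q i j) (ud j).
  by rewrite mxE; exact: (is_derive_sum_fun h).
have -> : (fun s => qform Q (u s)) =
    (fun s => \sum_i u s i 0 * (Q *m u s) i 0).
  by apply/funext => s; rewrite qform_sum.
have sym : \sum_i u t i 0 * (Q *m du) i 0 = \sum_i du i 0 * (Q *m u t) i 0.
  have E (a b : 'cV[R]_m) :
      \sum_i a i 0 * (Q *m b) i 0 = (a^T *m Q *m b) 0 0.
    by rewrite -mulmxA [RHS]mxE; apply: eq_bigr => i _; rewrite [a^T _ _]mxE.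
  rewrite !E (_ : (u t)^T *m Q *m du = (du^T *m Q *m u t)^T) ?mxE //.
  by rewrite !trmx_mul trmxK Qsym mulmxA.
have h i := is_deriveM (ud i) (Qd i).
have -> : 2 * \sum_i du i 0 * (Q *m u t) i 0 =
    \sum_i (u t i 0 *: (Q *m du) i 0 + (Q *m u t) i 0 *: du i 0).
  rewrite mulr2n mulrDl mul1r -{1}sym -big_split; apply: eq_bigr => i _ /=.
  by rewrite [du i 0 * _]mulrC.
exact: (is_derive_sum_fun h).
Qed.

(** The form of Q is a Lyapunov function.  The field is evaluated at the radial
    retraction of the state, which makes it globally Lipschitz and keeps the
    form nonincreasing everywhere; hence a trajectory that starts small never
    meets the truncation, and there the decay is exponential. *)
Lemma lotka_flow (r : R) : 0 < r -> (forall i, r < z i 0) ->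
  exists c lambda : R, [/\ 0 < c, 0 < lambda &
    forall u0, c * `|u0| <= r -> exists u : R -> 'cV[R]_m,
      [/\ u 0 = u0,
          forall t : R, 0 <= t -> forall i,
            is_derive t 1 (fun s => u s i 0) (lotka (u t) i 0) &
          forall t : R, 0 <= t ->
            `|u t| <= c * expR (- lambda * t) * `|u0|]].
Proof.
move=> r0 rz.
have [L L0 lip] := lotka_lip (ltW r0).
have [a a0 lower] := posdef_lower Qsym Qpos.
have [b b0 upper] := posdef_upper Q.
have [C C0 grad] := posdef_gradient Qsym Qpos.
have [kappa kappa0 kappaE] : exists2 kappa : R, 0 < kappa &
    forall i, kappa <= (tau i 0)^-1 * (z i 0 - r).
  have [|kappa k0 kE] := @positive_vec_lb _ _
      (\col_i ((tau i 0)^-1 * (z i 0 - r))).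
    by move=> i; rewrite mxE mulr_gt0 ?invr_gt0 ?subr_gt0 //; exact: tau_gt0.
  by exists kappa => // i; have := kE i; rewrite mxE.
(* (a b + 1)^2 >= a b: no square root is needed to compare norms *)
pose c := a * b + 1; pose lambda := kappa / C.
have ab0 : 0 < a * b by rewrite mulr_gt0.
have c0 : 0 < c by rewrite ltr_wpDl // ltW.
have c2 : a * b <= c ^+ 2 by rewrite /c; nra.
exists c, lambda; split => //; first by rewrite divr_gt0.
move=> u0 u0r.
pose g := lotka \o retract r.
have glip x y : `|g x - g y| <= (2 * L + 1) * `|x - y|.
  have h := lip _ _ (retract_norm r0 x) (retract_norm r0 y).
  apply: le_trans h _; have := ler_wpM2l L0 (retract_lip r0 x y).
  by have := normr_ge0 (x - y); lra.
have L1 : 0 < 2 * L + 1 by rewrite ltr_wpDl // mulr_ge0.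
have [u [u00 ud]] := lipschitz_flow u0 L1 glip.
have Vd (t : R) : 0 <= t -> is_derive t 1 (fun s => qform Q (u s))
    (2 * \sum_i g (u t) i 0 * (Q *m u t) i 0).
  by move=> t0; apply: is_derive_qform; exact: ud.
have Vc (T : R) : {within `[0, T], continuous (fun s => qform Q (u s))}.
  apply: derivable_within_continuous => t; rewrite in_itv /=.
  by move=> /andP[/Vd[]].
have dissip (t : R) : \sum_i g (u t) i 0 * (Q *m u t) i 0 <=
    - (kappa * shrink r (u t) * \sum_i (Q *m u t) i 0 ^+ 2).
  rewrite mulr_sumr -sumrN; apply: ler_sum => i _.
  have gE : g (u t) i 0 = - ((tau i 0)^-1 * (z i 0 + retract r (u t) i 0) *
      (shrink r (u t) * (Q *m u t) i 0)).
    rewrite /g /= mxE !mulNr; congr (- (_ * _)).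
    by rewrite /retract -scalemxAr mxE.
  have h1 : kappa <= (tau i 0)^-1 * (z i 0 + retract r (u t) i 0).
    apply: le_trans (kappaE i) _; rewrite ler_wpM2l ?invr_ge0 ?(ltW (tau_gt0 i)) //.
    rewrite lerD2l.
    have := le_trans (coord_le_mx_norm _ i 0) (retract_norm r0 (u t)).
    by rewrite ler_norml => /andP[].
  have h2 : 0 <= shrink r (u t) * (Q *m u t) i 0 ^+ 2.
    by rewrite mulr_ge0 ?sqr_ge0 // ltW // shrink_gt0.
  by have := ler_wpM2r h2 h1; rewrite gE; lra.
have Sge0 t : 0 <= \sum_i (Q *m u t) i 0 ^+ 2.
  by apply: sumr_ge0 => i _; exact: sqr_ge0.
have Vmono (t : R) : 0 <= t -> qform Q (u t) <= qform Q u0.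
  move=> t0; rewrite -u00.
  apply: (derive_nonincr (df := fun t => 2 * \sum_i g (u t) i 0 * (Q *m u t) i 0)
    t0 (Vc t)) => s /andP[/ltW s0 _]; first exact: Vd.
  rewrite pmulr_rle0 //; apply: le_trans (dissip s) _.
  by rewrite oppr_le0 mulr_ge0 // mulr_ge0 ?ltW // shrink_gt0.
have u_small (t : R) : 0 <= t -> `|u t| <= r.
  move=> t0; apply: le_trans u0r.
  rewrite -(@ler_pXn2r _ 2) ?nnegrE // ?mulr_ge0 ?(ltW c0) //.
  apply: le_trans (lower _) _.
  apply: le_trans (ler_wpM2l (ltW a0) (Vmono _ t0)) _.
  apply: le_trans (ler_wpM2l (ltW a0) (upper _)) _.
  by rewrite mulrA exprMn ler_wpM2r // exprn_ge0.
exists u; split => // [t t0 i|t t0].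
  by have := ud t t0 i; rewrite /g /= retract_id // u_small.
have Vdecay : qform Q (u t) <= expR (- (2 * lambda) * t) * qform Q u0.
  rewrite -u00; apply: (gronwall (dW := fun t => 2 * \sum_i g (u t) i 0 *
    (Q *m u t) i 0) t0 (Vc t)) => s /andP[/ltW s0 _]; first exact: Vd.
  have := dissip s.
  rewrite /shrink max_l ?u_small // divff ?gt_eqF // mulr1 => h.
  have h2 := grad (u s).
  rewrite mulNr -mulrA -mulrN ler_pM2l //; apply: le_trans h _.
  rewrite lerN2 /lambda mulrAC -mulrA ler_pM2l // ler_pdivrMr //.
  by rewrite mulrC.
rewrite -(@ler_pXn2r _ 2) ?nnegrE // ?mulr_ge0 ?expR_ge0 ?(ltW c0) //.
apply: le_trans (lower _) _.
apply: le_trans (ler_wpM2l (ltW a0) Vdecay) _.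
have e0 := expR_ge0 (- (2 * lambda) * t).
apply: le_trans (ler_wpM2l (ltW a0) (ler_wpM2l e0 (upper u0))) _.
rewrite !exprMn -expRM_natl.
have -> : 2%:R * (- lambda * t) = - (2 * lambda) * t by ring.
have -> : a * (expR (- (2 * lambda) * t) * (b * `|u0| ^+ 2)) =
  a * b * (expR (- (2 * lambda) * t) * `|u0| ^+ 2) by ring.
by rewrite -[leRHS]mulrA ler_wpM2r // mulr_ge0 // exprn_ge0.
Qed.

End Lotka.

(** * Derivatives on the half-line and first exit times *)

Section HalfLine.
Context {R : realType}.
Local Open Scope classical_set_scope.

Lemma is_derive_to_halfline p q (x : R -> 'M[R]_(p, q)) (t : R)
    (v : 'M[R]_(p, q)) :
  (forall i j, is_derive t 1 (fun s => x s i j) (v i j)) ->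
  is_derive_halfline x t v.
Proof.
move=> xd; apply: cvg_mx => i j.
have [/cvg_ex[l xl] <-] := xd i j.
rewrite /derive (cvg_lim _ xl) //.
apply: cvg_within_filter; apply: cvg_trans xl.
apply: near_eq_cvg; apply: nearW => h /=.
by rewrite !mxE /GRing.scale /= mulr1 [h + t]addrC.
Qed.

Lemma halfline_to_is_derive p q (x : R -> 'M[R]_(p, q)) (t : R)
    (v : 'M[R]_(p, q)) i j :
  0 < t -> is_derive_halfline x t v ->
  is_derive t 1 (fun s => x s i j) (v i j).
Proof.
move=> t0 xd.
have xw : (fun h : R => (h^-1 *: (x (t + h) - x t)) i j) @
    within [set h | 0 <= t + h] (0 : R)^' --> v i j.
  apply: (cvg_comp _ (fun M : 'M[R]_(p, q) => M i j) xd).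
  exact: coord_continuous.
have nt : \forall h \near (0 : R)^', 0 <= t + h.
  have := @dnbhs0_lt R R t t0; apply: filterS => h.
  by rewrite ltr_norml => /andP[? _]; lra.
have xij : h^-1 *: (((fun s => x s i j) \o shift t) (h *: (1 : R)) - x t i j)
    @[h --> (0 : R)^'] --> v i j.
  move=> U /xw; rewrite /within /= => hU.
  apply: filterS2 nt hU => h th /(_ th).
  by rewrite /= !mxE /GRing.scale /= mulr1 [h + t]addrC.
apply: DeriveDef; first by apply/cvg_ex; exists (v i j).
exact: cvg_lim xij.
Qed.

(** If phi reached b, consider the infimum T of the times where it does.  Before
    T the function is at most a < b, hence by continuity it is below b at T and
    shortly after T, against the choice of T. *)
Lemma first_exit (phi : R -> R) (a b : R) : a < b ->
  (forall (t eps : R), 0 <= t -> 0 < eps -> exists2 eta : R, 0 < eta &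
     forall s : R, 0 <= s -> `|t - s| < eta -> `|phi t - phi s| < eps) ->
  phi 0 < b ->
  (forall t : R, 0 <= t -> (forall s : R, 0 <= s <= t -> phi s < b) ->
     phi t <= a) ->
  forall t : R, 0 <= t -> phi t < b.
Proof.
move=> ab cont phi0 step t1 t10; rewrite ltNge; apply/negP => phit1.
pose S := [set s : R | 0 <= s /\ b <= phi s].
have S0 : S !=set0 by exists t1.
have Slb : lbound S 0 by move=> s [].
have infS : has_inf S by split => //; exists 0.
pose T := inf S.
have T0 : 0 <= T by exact: lb_le_inf.
have ltT (s : R) : 0 <= s -> s < T -> phi s < b.
  move=> s0 sT; rewrite ltNge; apply/negP => bs.
  by move: sT; rewrite ltNge ge_inf //; exists 0.
have leT (s : R) : 0 <= s -> s < T -> phi s <= a.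
  move=> s0 sT; apply: step => // s' /andP[s'0 s's].
  by apply: ltT => //; exact: le_lt_trans sT.
have phiT : phi T < b.
  rewrite ltNge; apply/negP => bT.
  have Tpos : 0 < T.
    rewrite lt_neqAle T0 andbT; apply/negP => /eqP T_eq0.
    by move: bT; rewrite -T_eq0 leNgt phi0.
  have [eta eta0 etaP] := cont T (b - a) T0 (etrans (subr_gt0 _ _) ab).
  pose s := Num.max 0 (T - eta / 2).
  have s0 : 0 <= s by rewrite le_max lexx.
  have sT : s < T by rewrite gt_max Tpos /=; lra.
  have sT' : T - eta / 2 <= s by rewrite le_max lexx orbT.
  have := etaP s s0; rewrite ger0_norm ?subr_ge0 ?(ltW sT) // => h.
  have {h} : `|phi T - phi s| < b - a by apply: h; lra.
  by rewrite ltr_norml => /andP[_]; have := leT s s0 sT; lra.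
have [eta eta0 etaP] := cont T (b - phi T) T0 (etrans (subr_gt0 _ _) phiT).
have [s [s0 bs] sT] := inf_adherent eta0 infS.
have Ts : T <= s by apply: ge_inf => //; exists 0.
have : `|phi T - phi s| < b - phi T.
  apply: etaP => //; rewrite distrC ger0_norm ?subr_ge0 //.
  by rewrite ltrBlDl.
by rewrite distrC ltr_norml => /andP[_]; lra.
Qed.

Lemma within_halfline_eps (V : normedModType R) (x : R -> V) :
  {within `[0, +oo[, continuous x} ->
  forall (t eps : R), 0 <= t -> 0 < eps -> exists2 eta : R, 0 < eta &
    forall s : R, 0 <= s -> `|t - s| < eta -> `|x t - x s| < eps.
Proof.
move=> xc t eps t0 eps0.
have At : `[0, +oo[ t by rewrite /= in_itv /= t0.
have /cvgrPdist_lt/(_ eps eps0) := xc t.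
rewrite /nbhs /= -(nbhs_subspace_in At) => /nbhs_ballP[eta /= eta0 etaP].
exists eta => // s s0 ts; apply: (etaP s) => //.
by rewrite /= in_itv /= s0.
Qed.

End HalfLine.

(** * Stability of the differential-algebraic system *)

Section GradientDAE.
Context {R : realType} {n m : nat}.
Local Open Scope classical_set_scope.
Variables (Q : 'M[R]_(n + m)) (tau : 'cV[R]_m) (ze : 'cV[R]_(n + m)).
Hypotheses (Qsym : Q^T = Q) (Qpos : posdef Q).
Hypotheses (tau_gt0 : positive_vec tau) (ze_gt0 : positive_vec ze).

(** The linearized algebraic equations determine the first block from the
    second one; the columns of this matrix span their solutions. *)
Definition load_lift : 'M[R]_(n + m, m) :=
  col_mx (- (invmx (ulsubmx Q) *m ursubmx Q)) 1%:M.

Definition reduced_mx : 'M[R]_m :=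
  drsubmx Q - dlsubmx Q *m invmx (ulsubmx Q) *m ursubmx Q.

Lemma load_liftE : Q *m load_lift = col_mx 0 reduced_mx.
Proof.
have uu := posdef_unitmx (posdef_ulsub Qpos).
rewrite -{1}[Q]submxK mul_block_col !mulmxN !mulmx1 !mulmxA mulmxV // mul1mx.
by rewrite addNr addrC.
Qed.

Lemma dsub_load_lift (u : 'cV[R]_m) : dsubmx (load_lift *m u) = u.
Proof. by rewrite mul_col_mx col_mxKd mul1mx. Qed.

Lemma load_lift_constraint (w : 'cV[R]_(n + m)) :
  usubmx (Q *m w) = 0 -> w = load_lift *m dsubmx w.
Proof.
have uu := posdef_unitmx (posdef_ulsub Qpos).
rewrite -{1}[Q]submxK -{1}[w]vsubmxK mul_block_col col_mxKu => Qw.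
rewrite mul_col_mx mul1mx -{1}[w]vsubmxK; congr col_mx.
rewrite mulNmx -mulmxA -[LHS](mulKmx uu) -mulmxN; congr (_ *m _).
by apply/eqP; rewrite -addr_eq0 Qw.
Qed.

Lemma reduced_mx_sym : reduced_mx^T = reduced_mx.
Proof.
rewrite /reduced_mx raddfB /= !trmx_mul trmx_inv trmx_drsub trmx_ursub.
by rewrite trmx_dlsub trmx_ulsub Qsym mulmxA.
Qed.

Lemma reduced_mx_posdef : posdef reduced_mx.
Proof.
move=> u u0; have : load_lift *m u != 0.
  apply: contraNneq u0 => Hu; rewrite -[u]dsub_load_lift Hu.
  by apply/eqP/matrixP => i j; rewrite !mxE.
move=> /Qpos; rewrite /qform -!mulmxA (mulmxA Q) load_liftE.
rewrite trmx_mul tr_col_mx trmx1 -mulmxA mul_col_mx mul_row_col.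
by rewrite mul0mx mulmx0 mul1mx add0r.
Qed.

(** Up to the factors x, this is minus the gradient of half the form of
    Q at the deviation from ze. *)
Definition gradient_field (x : 'cV[R]_(n + m)) : 'cV[R]_(n + m) :=
  - (diagv x *m (Q *m (x - ze))).

Let f := lotka reduced_mx (dsubmx ze) tau.

(** On the linearized constraint the system is the reduced Lotka-Volterra
    equation. *)
Lemma gradient_field_lift (u v : 'cV[R]_m) :
  (col_mx 0 (diagv tau *m v) = gradient_field (ze + load_lift *m u))
  <-> v = f u.
Proof.
have FE : gradient_field (ze + load_lift *m u) = col_mx 0
    (\col_i - ((dsubmx ze i 0 + u i 0) * (reduced_mx *m u) i 0)).
  rewrite /gradient_field [ze + _ - ze]addrC addKr (mulmxA Q) load_liftE.
  rewrite [col_mx 0 _ *m u]mul_col_mx mul0mx.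
  apply/colP => i; rewrite [LHS]mxE diagv_mulE; case: (split_ordP i) => j ->.
    by rewrite !col_mxEu !mxE mulr0 oppr0.
  rewrite !col_mxEd [in RHS]mxE; congr (- (_ * _)).
  by rewrite mxE -{2}(dsub_load_lift u) !mxE.
have tau_neq0 i : tau i 0 != 0 by rewrite gt_eqF.
rewrite FE; split => [/eq_col_mx[_] /colP E|->].
  apply/colP => i; have := E i; rewrite diagv_mulE [RHS]mxE => Ei.
  by rewrite -[LHS](mulKf (tau_neq0 i)) Ei [RHS]mxE; ring.
congr col_mx; apply/colP => i; rewrite diagv_mulE [f u i 0]mxE [RHS]mxE.
by field.
Qed.

(** Near ze all coordinates are positive, so the algebraic equations
    x_l (Q (x - ze))_l = 0 amount to the linear ones and the lifted flow is a
    solution.  An arbitrary solution could a priori branch off to x_l = 0 after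
    leaving a neighbourhood of ze; as long as it is within z0 of ze it agrees
    with the lifted flow, which stays within z0 / 2, so it never gets as far
    as z0. *)
Theorem gradient_dae_stable :
  dae_locally_exponentially_stable (diagv tau) gradient_field ze.
Proof.
have [z0 z0_gt0 z0E] := positive_vec_lb ze_gt0.
pose hH := \sum_i \sum_j `|load_lift i j| + 1.
have hH_ge1 : 1 <= hH.
  by rewrite lerDr; apply: sumr_ge0 => i _; exact: sumr_ge0.
have hH_gt0 : 0 < hH by exact: lt_le_trans hH_ge1.
have liftE (u : 'cV[R]_m) : `|load_lift *m u| <= hH * `|u|.
  by apply: le_trans (mulmx_norm_le _ _) _; rewrite ler_wpM2r // lerDl.
have dsub_norm (w : 'cV[R]_(n + m)) : `|dsubmx w| <= `|w|.
  by apply: mx_norm_leP => // i j; rewrite mxE coord_le_mx_norm.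
(* the radius for which the lift of the ball stays within z0 / 2 *)
pose r := z0 / (2 * hH).
have r_gt0 : 0 < r by rewrite divr_gt0 // mulr_gt0.
have hHr : hH * r = z0 / 2 by rewrite /r; field; rewrite gt_eqF.
have r_lt : r < z0.
  have : r <= hH * r by rewrite ler_peMl // ltW.
  by rewrite hHr; lra.
have rz i : r < dsubmx ze i 0.
  by rewrite mxE; exact: lt_le_trans (z0E _).
have [c [lambda [c_gt0 lambda_gt0 flow]]] :=
  lotka_flow reduced_mx_sym reduced_mx_posdef tau_gt0 r_gt0 rz.
have [L L_ge0 f_lip] := lotka_lip reduced_mx (dsubmx ze) tau (ltW z0_gt0).
(* close to ze all coordinates are positive, so the algebraic equations are
   linear there *)
have near_lift (w : 'cV[R]_(n + m)) : usubmx (gradient_field w) = 0 ->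
    `|w - ze| < z0 -> w = ze + load_lift *m dsubmx (w - ze).
  move=> Fw wz; rewrite -load_lift_constraint; first by rewrite addrC subrK.
  apply/colP => i; have /colP/(_ i) := Fw.
  rewrite [in LHS]mxE [in LHS]mxE diagv_mulE [RHS]mxE => /eqP.
  rewrite oppr_eq0 mulf_eq0 => /orP[/eqP w0|/eqP]; last by rewrite !mxE.
  have := lt_le_trans wz (z0E (lshift m i)).
  move=> /(le_lt_trans (coord_le_mx_norm _ (lshift m i) 0)).
  by rewrite mx_subE w0 sub0r normrN gtr0_norm ?ltxx.
have lift_stay (u : 'cV[R]_m) : `|u| <= r -> `|load_lift *m u| <= z0 / 2.
  by move=> ur; apply: le_trans (liftE u) _; rewrite -hHr ler_wpM2l // ltW.
pose delta := Num.min (r / c) z0.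
exists delta, (hH * c), lambda; split => //.
- by rewrite lt_min divr_gt0.
- by rewrite mulr_gt0.
move=> x0 Fx0 x0_near.
have x0z : `|x0 - ze| < z0 by apply: lt_le_trans x0_near _; rewrite ge_min lexx orbT.
pose u0 := dsubmx (x0 - ze).
have u0r : c * `|u0| <= r.
  rewrite mulrC -ler_pdivlMr //; apply: le_trans (dsub_norm _) _.
  by rewrite (le_trans (ltW x0_near)) // ge_min lexx.
have [u [u00 ud udecay]] := flow u0 u0r.
have u_small (t : R) : 0 <= t -> `|u t| <= r.
  move=> t0; apply: le_trans (udecay t t0) (le_trans _ u0r).
  rewrite ler_wpM2r // ler_piMr ?(ltW c_gt0) // -expR0 ler_expR mulNr oppr_le0.
  by rewrite mulr_ge0 // ltW.
pose x (t : R) := ze + load_lift *m u t.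
have xd (t : R) i : 0 <= t ->
    is_derive t 1 (fun s => x s i 0) ((load_lift *m f (u t)) i 0).
  move=> t0; have h j := is_deriveZ (load_lift i j) (ud t t0 j).
  have := is_deriveD (is_derive_cst (ze i 0) t 1) (is_derive_sum_fun h).
  rewrite add0r [X in _ -> is_derive _ _ _ X]mxE.
  congr is_derive; apply/funext => s.
  by rewrite /x mxE; congr (_ + _); rewrite mxE.
have x_sol : dae_solution (diagv tau) gradient_field x0 x.
  split.
  - by rewrite /x u00 -near_lift.
  - apply: continuous_in_subspaceT => t; rewrite inE /= in_itv /= andbT => t0.
    apply: cvg_mx => i j; rewrite ord1.
    by have [/derivable1_diffP/differentiable_continuous] := xd t i t0.
  - move=> t t0; exists (f (u t)); last exact/gradient_field_lift.
    apply: is_derive_to_halfline => i j; rewrite ord1.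
    have := is_deriveD (is_derive_cst (dsubmx ze i 0) t 1) (ud t t0 i).
    rewrite add0r; congr is_derive; apply/funext => s.
    rewrite /x raddfD /= dsub_load_lift [RHS]mxE; by [].
exists x; split => //; last first.
  move=> t t0; rewrite /x [ze + _ - _]addrC addKr.
  apply: le_trans (liftE _) _; rewrite -!mulrA ler_wpM2l ?(ltW hH_gt0) //.
  apply: le_trans (udecay t t0) _; rewrite mulrA ler_wpM2l ?dsub_norm //.
  by rewrite mulr_ge0 ?expR_ge0 // ltW.
move=> y [y0 yc yd].
have yF (t : R) : 0 <= t -> usubmx (gradient_field (y t)) = 0.
  by move=> t0; have [v _ <-] := yd t t0; rewrite col_mxKu.
pose v (t : R) := dsubmx (y t - ze).
have agree (T : R) : 0 <= T ->
    (forall s : R, 0 <= s <= T -> `|y s - ze| < z0) -> y T = x T.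
  move=> T0 yz.
  have yE (s : R) : 0 <= s <= T -> y s = ze + load_lift *m v s.
    by move=> sT; apply: near_lift (yz s sT); apply: yF; case/andP: sT.
  rewrite (yE T) ?T0 ?lexx // /x; congr (_ + _ *m _).
  apply: (@ode_unique _ _ f (fun w => `|w| <= z0) L T v u) => //.
  - move=> i; have -> : (fun s => v s i 0) =
        (fun s => y s (rshift n i) 0 - ze (rshift n i) 0).
      by apply/funext => s; rewrite /v mxE mx_subE.
    have yc' : {within `[0, T], continuous y}.
      by apply: continuous_subspaceW yc => s; rewrite /= !in_itv /= => /andP[->].
    move=> s; apply: cvgB; last exact: cvg_cst.
    apply: (cvg_comp y (fun M : 'cV[R]_(n + m) => M (rshift n i) 0) (yc' s)).
    exact: coord_continuous.
  - move=> i; apply: derivable_within_continuous => s.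
    by rewrite in_itv /= => /andP[s0 _]; have [] := ud s s0 i.
  - move=> t /andP[/ltW t0 /ltW tT]; split.
      by apply: le_trans (dsub_norm _) (ltW (yz t _)); rewrite t0.
    exact: le_trans (u_small t t0) (ltW r_lt).
  - move=> t /andP[t0 /ltW tT] i.
    have [w yw /esym wE] := yd t (ltW t0).
    have tT' : 0 <= t <= T by rewrite ltW.
    rewrite (yE t tT') in wE; move/esym/gradient_field_lift: wE => wE.
    have := is_deriveB (halfline_to_is_derive i 0 t0 yw)
      (is_derive_cst (dsubmx ze i 0) t 1).
    rewrite subr0 wE; congr is_derive; apply/funext => s.
    by transitivity (dsubmx (y s) i 0 - dsubmx ze i 0); rewrite // /v !mxE.
  - by move=> t /andP[/ltW t0 _]; exact: ud.
  - by rewrite /v y0 u00.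
have y_stays : forall t : R, 0 <= t -> `|y t - ze| < z0.
  apply: (@first_exit _ (fun t => `|y t - ze|) (z0 / 2)); first by lra.
  - move=> t eps t0 eps0.
    have [eta eta0 etaP] := within_halfline_eps yc t0 eps0.
    exists eta => // s s0 ts; apply: le_lt_trans (etaP s s0 ts).
    apply: le_trans (ler_dist_dist _ _) _.
    by rewrite opprB addrA subrK.
  - by rewrite y0.
  - move=> t t0 yz; rewrite (agree t t0 yz) /x [ze + _ - _]addrC addKr.
    exact: lift_stay (u_small t t0).
by move=> t t0; apply: agree => // s /andP[s0 _]; exact: y_stays.
Qed.

End GradientDAE.

(** * The microgrid *)

Unset Implicit Arguments.
Set Strict Implicit.
Set Printing Implicit Defensive.

Theorem mainTheorem6 (R : realType) (n m : nat) (n_gt0 : (0 < n)%N)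
    (m_gt0 : (0 < m)%N)
    (e : rel 'I_(n + m)) (B : 'M[R]_(n + m))
    (graph_e : connected_graph e) (susc_B : susceptance_matrix e B)
    (K kappa tau Estar : 'cV[R]_m) (b : 'cV[R]_n)
    (K_lt0 : negative_vec K) (kappa_lt0 : negative_vec kappa)
    (tau_gt0 : positive_vec tau) (Estar_gt0 : positive_vec Estar)
    (M_shunt : M_matrix (- (Bred B K + diagv b)))
    (K_kappa : forall i, K i 0 = kappa i 0) :
  (* the inverses in the formulas exist *)
  [/\ drsubmx B + diagv K \in unitmx, Bred B K \in unitmx &
      Bred B K + diagv b \in unitmx] /\
  let EL := EL_Z B K b Estar in
  let EI := EI_Z B K b Estar in
  let F := closed_loop B K b Estar in
  [/\ positive_vec EL,
      positive_vec EI,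
      unique (fun E => [/\ positive_vec E, dae_equilibrium F E &
                dae_locally_exponentially_stable (diagv tau) F E])
             (col_mx EL EI) &
      unique (positive_minimizer (cost e B kappa b Estar)) (col_mx EL EI)].
Proof.
have D_unit := inverter_block_unitmx m_gt0 graph_e susc_B K_lt0.
have Bred_unit := Bred_unitmx m_gt0 graph_e susc_B K_lt0.
have shunt_unit := posdefN_unitmx (shunted_Bred_posdef susc_B M_shunt).
split; first by split.
move=> EL EI F.
pose A := grid_mx B K b; pose Ez := col_mx EL EI.
have Asym : (- A)^T = - A by rewrite raddfN /= (grid_mx_sym K susc_B).
have Apos : posdef (- A) := grid_posdef m_gt0 graph_e susc_B K_lt0 M_shunt.
have Az : A *m Ez = grid_rhs K Estar by exact: grid_solution.
have EzP : positive_vec Ez :=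
  grid_solution_positive m_gt0 graph_e susc_B K_lt0 M_shunt Estar_gt0 Az.
have FE : F = gradient_field (- A) Ez.
  apply/funext => E; rewrite /F closed_loopE /gradient_field.
  by rewrite -Az -/A -mulmxBr mulNmx mulmxN opprK.
have costE E : cost e B kappa b Estar E - cost e B kappa b Estar Ez =
    qform (- A) (E - Ez).
  have -> : kappa = K by apply/colP => i; rewrite K_kappa.
  exact: cost_sub.
split.
- by move=> i; have := EzP (lshift m i); rewrite col_mxEu.
- by move=> i; have := EzP (rshift n i); rewrite col_mxEd.
- split.
    split => //; first by rewrite /dae_equilibrium FE /gradient_field subrr
      !mulmx0 oppr0.
    by rewrite FE; exact: gradient_dae_stable.
  move=> E [Epos]; rewrite /dae_equilibrium /F closed_loopE -/A => EF _.
  have AE : A *m E = grid_rhs K Estar.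
    apply/eqP; rewrite -subr_eq0; apply/eqP/colP => i.
    have /colP/(_ i)/eqP := EF; rewrite diagv_mulE [X in _ == X]mxE.
    by rewrite mulf_eq0 gt_eqF //= => /eqP ->; rewrite mxE.
  have A_unit : A \in unitmx.
    exact: posdefN_unitmx.
  by rewrite -[LHS](mulKmx A_unit) Az -AE mulKmx.
- split.
    split => // E _; rewrite -subr_ge0 costE; exact: posdef_ge0.
  move=> E [_ /(_ Ez EzP)]; rewrite -subr_le0 costE => Emin.
  apply/eqP; rewrite eq_sym -subr_eq0; apply/negP => /negP/Apos.
  by rewrite ltNge Emin.
Qed.
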